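(* Assume, in the standing setting, that $\mathbf A^{\sharp}\mathbf A$ and $\mathbf B\mathbf B^{\sharp}$ are both non-Hermitian. Then for all $i=1,\dots,n$, $j=1,\dots,p$ the entries of $\mathbf X=\mathbf A^{\dagger}_{M,N}\mathbf D\mathbf B^{\dagger}_{P,Q}$ satisfy the following, where in each case $\widetilde{\mathbf D}=(\widetilde d_{tf})\in\mathbb H^{n\times p}$ has rows $\widetilde{\mathbf d}_{t.}$ and columns $\widetilde{\mathbf d}_{.f}$, and $\Delta_A=\sum_{\beta\in J_{r_1,n}}\det((\widetilde{\mathbf A}^*\widetilde{\mathbf A})^{\beta}_{\beta})$, $\Delta_B=\sum_{\alpha\in I_{r_2,p}}\det((\widetilde{\mathbf B}\widetilde{\mathbf B}^* )^{\alpha}_{\alpha})$. (i) If $r_1<n$, $r_2<p$: let $\widetilde{\mathbf D}=\mathbf N^{-1/2}\mathbf A^*\mathbf M\mathbf D\mathbf Q^{-1}\mathbf B^*\mathbf P^{1/2}$; let $\mathbf d^{\mathbf B}_{.j}\in\mathbb H^{n\times1}$ have $t$-th entry $\sum_{l=1}^{p}\sum_{\alpha\in I_{r_2,p}\{l\}}\operatorname{rdet}_l\big((\widetilde{\mathbf B}\widetilde{\mathbf B}^* )_{l.}(\widetilde{\mathbf d}_{t.})\big)^{\alpha}_{\alpha}\,p^{(1/2)}_{lj}$ and $\mathbf d^{\mathbf A}_{i.}\in\mathbb H^{1\times p}$ have $f$-th entry $\sum_{k=1}^{n}n^{(-1/2)}_{ik}\sum_{\beta\in J_{r_1,n}\{k\}}\operatorname{cdet}_k\big((\widetilde{\mathbf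 A}^*\widetilde{\mathbf A})_{.k}(\widetilde{\mathbf d}_{.f})\big)^{\beta}_{\beta}$. Then $$x_{ij}=\frac{\sum_{k=1}^{n}n^{(-1/2)}_{ik}\sum_{\beta\in J_{r_1,n}\{k\}}\operatorname{cdet}_k\big((\widetilde{\mathbf A}^*\widetilde{\mathbf A})_{.k}(\mathbf d^{\mathbf B}_{.j})\big)^{\beta}_{\beta}}{\Delta_A\Delta_B}=\frac{\sum_{l=1}^{p}\sum_{\alpha\in I_{r_2,p}\{l\}}\operatorname{rdet}_l\big((\widetilde{\mathbf B}\widetilde{\mathbf B}^* )_{l.}(\mathbf d^{\mathbf A}_{i.})\big)^{\alpha}_{\alpha}\,p^{(1/2)}_{lj}}{\Delta_A\Delta_B}.$$ (ii) If $r_1=n$, $r_2=p$: let $\widetilde{\mathbf D}=\mathbf A^*\mathbf M\mathbf D\mathbf Q^{-1}\mathbf B^*$; let $\mathbf d^{\mathbf B}_{.j}$ have $t$-th entry $\operatorname{rdet}_j(\mathbf B\mathbf Q^{-1}\mathbf B^* )_{j.}(\widetilde{\mathbf d}_{t.})$ and $\mathbf d^{\mathbf A}_{i.}$ have $f$-th entry $\operatorname{cdet}_i(\mathbf A^*\mathbf M\mathbf A)_{.i}(\widetilde{\mathbf d}_{.f})$. Then $$x_{ij}=\frac{\operatorname{cdet}_i(\mathbf A^*\mathbf M\mathbf A)_{.i}(\mathbf d^{\mathbf B}_{.j})}{\det(\mathbf A^*\mathbf M\mathbf A)\det(\mathbf B\mathbf Q^{-1}\mathbf B^* )}=\frac{\operatorname{rdet}_j(\mathbf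 B\mathbf Q^{-1}\mathbf B^* )_{j.}(\mathbf d^{\mathbf A}_{i.})}{\det(\mathbf A^*\mathbf M\mathbf A)\det(\mathbf B\mathbf Q^{-1}\mathbf B^* )}.$$ (iii) If $r_1=n$, $r_2<p$: let $\widetilde{\mathbf D}=\mathbf A^*\mathbf M\mathbf D\mathbf Q^{-1}\mathbf B^*\mathbf P^{1/2}$; define $\mathbf d^{\mathbf B}_{.j}$ by the formula of (i) and $\mathbf d^{\mathbf A}_{i.}$ by the formula of (ii), both using this $\widetilde{\mathbf D}$. Then $$x_{ij}=\frac{\operatorname{cdet}_i(\mathbf A^*\mathbf M\mathbf A)_{.i}(\mathbf d^{\mathbf B}_{.j})}{\det(\mathbf A^*\mathbf M\mathbf A)\,\Delta_B}=\frac{\sum_{l=1}^{p}\sum_{\alpha\in I_{r_2,p}\{l\}}\operatorname{rdet}_l\big((\widetilde{\mathbf B}\widetilde{\mathbf B}^* )_{l.}(\mathbf d^{\mathbf A}_{i.})\big)^{\alpha}_{\alpha}\,p^{(1/2)}_{lj}}{\det(\mathbf A^*\mathbf M\mathbf A)\,\Delta_B}.$$ (iv) If $r_1<n$, $r_2=p$: let $\widetilde{\mathbf D}=\mathbf N^{-1/2}\mathbf A^*\mathbf M\mathbf D\mathbf Q^{-1}\mathbf B^*$; define $\mathbf d^{\mathbf B}_{.j}$ by the formula of (ii) and $\mathbf d^{\mathbf A}_{i.}$ by the formula of (i), both using this $\widetilde{\mathbf D}$. Then $$x_{ij}=\frac{\operatorname{rdet}_j(\mathbf B\mathbf Q^{-1}\mathbf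 B^* )_{j.}(\mathbf d^{\mathbf A}_{i.})}{\Delta_A\det(\mathbf B\mathbf Q^{-1}\mathbf B^* )}=\frac{\sum_{k=1}^{n}n^{(-1/2)}_{ik}\sum_{\beta\in J_{r_1,n}\{k\}}\operatorname{cdet}_k\big((\widetilde{\mathbf A}^*\widetilde{\mathbf A})_{.k}(\mathbf d^{\mathbf B}_{.j})\big)^{\beta}_{\beta}}{\Delta_A\det(\mathbf B\mathbf Q^{-1}\mathbf B^* )}.$$
   Context: $\mathbb H$ is the real quaternion skew field; $\mathbb H^{m\times n}$ the $m\times n$ quaternion matrices; $\mathrm M(n,\mathbb H)=\mathbb H^{n\times n}$; $\mathbf C^*$ the conjugate transpose; rank is the maximal number of right-linearly independent columns. A square $\mathbf H$ is Hermitian if $\mathbf H^*=\mathbf H$, positive definite if also $\mathbf x^*\mathbf H\mathbf x>0$ for all nonzero $\mathbf x$. For Hermitian positive definite $\mathbf H$, $\mathbf H^{1/2}$ is its unique Hermitian positive definite square root and $\mathbf H^{-1/2}=(\mathbf H^{1/2})^{-1}$. Row and column determinants of $\mathbf C=(c_{ij})\in\mathrm M(n,\mathbb H)$: for $i\in\{1,\dots,n\}$, write each $\sigma\in S_n$ as a product of $r$ disjoint cycles (fixed points included) as $\sigma=(i\,i_{k_1}\,i_{k_1+1}\dots i_{k_1+l_1})(i_{k_2}\dots i_{k_2+l_2})\cdots(i_{k_r}\dots i_{k_r+l_r})$, where the first cycle contains $i$ and starts with $i$, every other cycle starts with its smallest element, and $i_{k_2}<\dots<i_{k_r}$; then $\operatorname{rdet}_i\mathbf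 C=\sum_{\sigma\in S_n}(-1)^{n-r}(c_{i\,i_{k_1}}c_{i_{k_1}i_{k_1+1}}\cdots c_{i_{k_1+l_1}\,i})\cdots(c_{i_{k_r}i_{k_r+1}}\cdots c_{i_{k_r+l_r}i_{k_r}})$. For $j\in\{1,\dots,n\}$, write each $\tau\in S_n$ as $\tau=(j_{k_r+l_r}\dots j_{k_r+1}j_{k_r})\cdots(j_{k_2+l_2}\dots j_{k_2})(j_{k_1+l_1}\dots j_{k_1+1}j_{k_1}\,j)$, where the last cycle contains $j$ and ends with $j$, every other cycle ends with its smallest element, and $j_{k_2}<\dots<j_{k_r}$; then $\operatorname{cdet}_j\mathbf C=\sum_{\tau\in S_n}(-1)^{n-r}(c_{j_{k_r}j_{k_r+l_r}}\cdots c_{j_{k_r+1}j_{k_r}})\cdots(c_{j\,j_{k_1+l_1}}\cdots c_{j_{k_1+1}j_{k_1}}c_{j_{k_1}j})$. For Hermitian $\mathbf C$ all $\operatorname{rdet}_i\mathbf C$ and $\operatorname{cdet}_j\mathbf C$ coincide and are real; this common value is $\det\mathbf C$. Notation: $\mathbf c_{.j}$, $\mathbf c_{i.}$ are the $j$-th column and $i$-th row of $\mathbf C$; $\mathbf C_{.j}(\mathbf b)$ (resp. $\mathbf C_{i.}(\mathbf b)$) is $\mathbf C$ with its $j$-th column (resp. $i$-th row) replaced by $\mathbf b$. $\mathbf C^{\alpha}_{\beta}$ is the submatrix with rows indexed by $\alpha$ and columns by $\beta$. $L_{k,n}$ is the set of strictly increasing sequences of $k$ integers from $\{1,\dots,n\}$;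 $I_{r,m}\{i\}=\{\alpha\in L_{r,m}: i\in\alpha\}$, $J_{r,n}\{j\}=\{\beta\in L_{r,n}: j\in\beta\}$, and $I_{r,m}=L_{r,m}$, $J_{r,n}=L_{r,n}$. For $i\in\beta$, $\operatorname{cdet}_i(\mathbf C_{.i}(\mathbf b))^{\beta}_{\beta}$ is the column determinant of the square matrix $(\mathbf C_{.i}(\mathbf b))^{\beta}_{\beta}$ with respect to its column corresponding to index $i$; similarly $\operatorname{rdet}_j(\mathbf C_{j.}(\mathbf b))^{\alpha}_{\alpha}$ for $j\in\alpha$ with respect to the row corresponding to $j$. Weighted Moore–Penrose inverse: for $\mathbf A\in\mathbb H^{m\times n}$ and Hermitian positive definite $\mathbf M$ (order $m$), $\mathbf N$ (order $n$), $\mathbf A^{\dagger}_{M,N}$ is the unique $\mathbf Y\in\mathbb H^{n\times m}$ with $\mathbf A\mathbf Y\mathbf A=\mathbf A$, $\mathbf Y\mathbf A\mathbf Y=\mathbf Y$, $(\mathbf M\mathbf A\mathbf Y)^*=\mathbf M\mathbf A\mathbf Y$, $(\mathbf N\mathbf Y\mathbf A)^*=\mathbf N\mathbf Y\mathbf A$. Standing setting: $\mathbf A\in\mathbb H^{m\times n}$ of rank $r_1\ge1$, $\mathbf B\in\mathbb H^{p\times q}$ of rank $r_2\ge1$, $\mathbf D\in\mathbb H^{m\times q}$; $\mathbf M,\mathbf N,\mathbf P,\mathbf Q$ Hermitian positive definite of orders $m,n,p,q$. $\mathbf A^{\sharp}=\mathbf N^{-1}\mathbf A^*\mathbf M$,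 $\mathbf B^{\sharp}=\mathbf Q^{-1}\mathbf B^*\mathbf P$, $\widetilde{\mathbf A}=\mathbf M^{1/2}\mathbf A\mathbf N^{-1/2}$, $\widetilde{\mathbf B}=\mathbf P^{1/2}\mathbf B\mathbf Q^{-1/2}$; $n^{(-1/2)}_{ik}$ are the entries of $\mathbf N^{-1/2}$ and $p^{(1/2)}_{lj}$ those of $\mathbf P^{1/2}$. $\mathbf X=(x_{ij}):=\mathbf A^{\dagger}_{M,N}\mathbf D\mathbf B^{\dagger}_{P,Q}\in\mathbb H^{n\times p}$ (this is the unique solution of $\mathbf A\mathbf X\mathbf B=\mathbf D$ under the paper's range restrictions). *)

(* Defs.v *)
From HB Require Import structures.
From mathcomp Require Import all_boot all_order all_fingroup all_algebra.
Set Implicit Arguments. Unset Strict Implicit. Unset Printing Implicit Defensive.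
Import Order.TTheory GRing.Theory Num.Theory.
Local Open Scope ring_scope.

(* Real quaternions are built as H(R) = R^4 (row vectors
   'rV[R]_4, basis 1,i,j,k at indices 0,1,2,3) with the Hamilton product,
   equipped with a (non-commutative) ring structure below.  R is later
   instantiated with an arbitrary real closed field (rcfType). *)

Definition qidx (i j : 'I_4) : nat :=
  match val i, val j with
  | 0, y => y | x, 0 => x
  | 1, 1 => 0 | 2, 2 => 0 | 3, 3 => 0
  | 1, 2 => 3 | 2, 1 => 3 | 2, 3 => 1 | 3, 2 => 1 | 3, 1 => 2 | 1, 3 => 2
  | _, _ => 0 end.
Definition qsgn (i j : 'I_4) : int :=
  match val i, val j with
  | 0, _ => 1 | _, 0 => 1
  | 1, 1 => -1 | 2, 2 => -1 | 3, 3 => -1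
  | 1, 2 => 1 | 2, 1 => -1 | 2, 3 => 1 | 3, 2 => -1 | 3, 1 => 1 | 1, 3 => -1
  | _, _ => 0 end.
Definition qc (i j k : 'I_4) : int := if val k == qidx i j then qsgn i j else 0.

Lemma qc_assoc (i j m k : 'I_4) :
  \sum_(l < 4) qc i j l * qc l m k = \sum_(l < 4) qc j m l * qc i l k.
Proof.
rewrite !big_ord_recr !big_ord0 /=.
case: i => [[|[|[|[|i]]]] Hi] //; case: j => [[|[|[|[|j]]]] Hj] //;
case: m => [[|[|[|[|m]]]] Hm] //; case: k => [[|[|[|[|k]]]] Hk] //.
Qed.

Section Q.
Variable R : comNzRingType.
Definition quat : Type := 'rV[R]_4.
HB.instance Definition _ := GRing.Zmodule.on quat.

Definition qmul (p q : quat) : quat :=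
  \row_k \sum_(i < 4) \sum_(j < 4) (qc i j k)%:~R * (p 0 i * q 0 j).
Definition qone : quat := \row_k (k == 0 :> 'I_4)%:R.

Lemma sum_intr (F G : 'I_4 -> int) (X : R) :
  \sum_(l < 4) F l = \sum_(l < 4) G l ->
  \sum_(l < 4) (F l)%:~R * X = \sum_(l < 4) (G l)%:~R * X.
Proof. by move=> e; rewrite -!mulr_suml -!rmorph_sum e. Qed.

Lemma mulr_help (a b x y : R) : a * (x * (b * y)) = (b * a) * (x * y).
Proof. by rewrite (mulrCA x b y) (mulrA a b) (mulrC a b). Qed.

Lemma mulr_help2 (a b x y z : R) : a * (b * (x * y) * z) = (b * a) * (x * (y * z)).
Proof. by rewrite -(mulrA b) -(mulrA x) (mulrA a b) (mulrC a b). Qed.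

Lemma sum4_perm (F : 'I_4 -> 'I_4 -> 'I_4 -> 'I_4 -> R) :
  \sum_(i < 4) \sum_(j < 4) \sum_(m < 4) \sum_(l < 4) F l m i j =
  \sum_(l < 4) \sum_(m < 4) \sum_(i < 4) \sum_(j < 4) F l m i j.
Proof.
symmetry.
rewrite (eq_bigr (fun l => \sum_(i < 4) \sum_(j < 4) \sum_(m < 4) F l m i j)); last first.
  by move=> l _; rewrite exchange_big; apply: eq_bigr => i _; rewrite exchange_big.
rewrite exchange_big; apply: eq_bigr => i _.
rewrite exchange_big; apply: eq_bigr => j _.
by rewrite exchange_big.
Qed.

Lemma qmulA : associative qmul.
Proof.
move=> p q r; apply/rowP=> k; rewrite /qmul !mxE.
transitivity (\sum_(i < 4) \sum_(j < 4) \sum_(m < 4) \sum_(l < 4)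
   ((qc j m l * qc i l k)%:~R * (p 0 i * (q 0 j * r 0 m)) : R)).
  transitivity (\sum_(i < 4) \sum_(l < 4) \sum_(j < 4) \sum_(m < 4)
   ((qc j m l * qc i l k)%:~R * (p 0 i * (q 0 j * r 0 m)) : R)).
    apply: eq_bigr => i _; apply: eq_bigr => l _; rewrite mxE mulr_sumr mulr_sumr.
    apply: eq_bigr => j _; rewrite mulr_sumr mulr_sumr; apply: eq_bigr => m _.
    by rewrite intrM mulr_help.
  apply: eq_bigr => i _ /=.
  rewrite exchange_big; apply: eq_bigr => j _ /=.
  by rewrite exchange_big.
transitivity (\sum_(i < 4) \sum_(j < 4) \sum_(m < 4) \sum_(l < 4)
   ((qc i j l * qc l m k)%:~R * (p 0 i * (q 0 j * r 0 m)) : R)).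
  apply: eq_bigr => i _; apply: eq_bigr => j _; apply: eq_bigr => m _.
  by apply: sum_intr; rewrite qc_assoc.
transitivity (\sum_(l < 4) \sum_(m < 4) \sum_(i < 4) \sum_(j < 4)
   ((qc i j l * qc l m k)%:~R * (p 0 i * (q 0 j * r 0 m)) : R)); last first.
  apply: eq_bigr => l _; apply: eq_bigr => m _; rewrite mxE mulr_suml mulr_sumr.
  apply: eq_bigr => i _; rewrite mulr_suml mulr_sumr; apply: eq_bigr => j _.
  by rewrite intrM mulr_help2.
exact: sum4_perm.
Qed.

Lemma qc0l (j k : 'I_4) : qc 0 j k = (k == j)%:R.
Proof.
by case: j => [[|[|[|[|j]]]] Hj] //; case: k => [[|[|[|[|k]]]] Hk].
Qed.

Lemma qc0r (i k : 'I_4) : qc i 0 k = (k == i)%:R.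
Proof.
by case: i => [[|[|[|[|i]]]] Hi] //; case: k => [[|[|[|[|k]]]] Hk].
Qed.

Lemma qmul1 : left_id qone qmul.
Proof.
move=> q; apply/rowP=> k; rewrite /qmul /qone mxE (bigD1 ord0) //= [X in _ + X]big1 ?addr0.
  rewrite (bigD1 k) //= [X in _ + X]big1 ?addr0; first by rewrite !mxE qc0l eqxx mul1r mul1r.
  by move=> j /negbTE njk; rewrite !mxE qc0l eq_sym njk mul0r.
by move=> i /negbTE ni0; apply: big1 => j _; rewrite !mxE ni0 mul0r mulr0.
Qed.

Lemma qmul1r : right_id qone qmul.
Proof.
move=> q; apply/rowP=> k; rewrite /qmul /qone mxE (bigD1 k) //= [X in _ + X]big1 ?addr0.
  rewrite (bigD1 ord0) //= [X in _ + X]big1 ?addr0; first by rewrite !mxE qc0r eqxx mul1r mulr1.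
  by move=> j /negbTE nj0; rewrite !mxE nj0 !mulr0.
move=> i /negbTE nik; rewrite (bigD1 ord0) //= [X in _ + X]big1 ?addr0.
  by rewrite !mxE qc0r eq_sym nik mul0r.
by move=> j /negbTE nj0; rewrite !mxE nj0 !mulr0.
Qed.

Lemma qmulDl : left_distributive qmul +%R.
Proof.
move=> p q r; apply/rowP=> k; rewrite /qmul !mxE -big_split; apply: eq_bigr => i _.
rewrite -big_split; apply: eq_bigr => j _ /=; by rewrite !mxE mulrDl mulrDr.
Qed.

Lemma qmulDr : right_distributive qmul +%R.
Proof.
move=> p q r; apply/rowP=> k; rewrite /qmul !mxE -big_split; apply: eq_bigr => i _.
rewrite -big_split; apply: eq_bigr => j _ /=; by rewrite !mxE mulrDr mulrDr.
Qed.

Lemma qone_neq0 : qone != 0.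
Proof.
apply/negP=> /eqP /rowP /(_ ord0); rewrite !mxE /= => /eqP; by rewrite oner_eq0.
Qed.

HB.instance Definition _ := GRing.Zmodule_isNzRing.Build quat
  qmulA qmul1 qmul1r qmulDl qmulDr qone_neq0.

Definition qconj (x : quat) : quat := \row_k (if k == ord0 then x 0 k else - x 0 k).
Definition qre (x : quat) : R := x 0 ord0.
Definition qreal (a : R) : quat := \row_k (if k == ord0 then a else 0).

End Q.

Arguments qreal {R}.

Section QMatrices.
Variable R : comNzRingType.
Local Notation H := (quat R).

Definition qadj (m n : nat) (C : 'M[H]_(m, n)) : 'M[H]_(n, m) :=
  \matrix_(i, j) qconj (C j i).

Definition qhermitian (n : nat) (C : 'M[H]_n) : Prop := qadj C = C.

Definition rindep (m n : nat) (A : 'M[H]_(m, n)) (S : {set 'I_n}) : Prop :=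
  forall lam : 'I_n -> H,
    (forall i : 'I_m, \sum_(j in S) A i j * lam j = 0) ->
    forall j, j \in S -> lam j = 0.

Definition qrank (m n : nat) (A : 'M[H]_(m, n)) (r : nat) : Prop :=
  (exists S : {set 'I_n}, rindep A S /\ #|S| = r) /\
  (forall S : {set 'I_n}, rindep A S -> (#|S| <= r)%N).

Definition wmp (m n : nat) (M : 'M[H]_m) (N : 'M[H]_n)
    (A : 'M[H]_(m, n)) (Y : 'M[H]_(n, m)) : Prop :=
  [/\ A *m Y *m A = A, Y *m A *m Y = Y,
      qhermitian (M *m A *m Y) & qhermitian (N *m Y *m A)].

Definition cycprod (n : nat) (C : 'M[H]_n) (s : 'S_n) (x : 'I_n) : H :=
  \prod_(t < #|porbit s x|) C ((s ^+ t)%g x) ((s ^+ t.+1)%g x).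

Definition cycmin (n : nat) (s : 'S_n) (x : 'I_n) : bool :=
  [forall y in porbit s x, (x <= y)%N].

(* row determinant rdet_i: the cycle of i first (starting at i), then the
   other cycles, each starting at its smallest element, in increasing
   order of these smallest elements; r = number of cycles *)
Definition rdet (n : nat) (C : 'M[H]_n) (i : 'I_n) : H :=
  \sum_(s : 'S_n) (-1) ^+ (n - #|porbits s|) *
    (cycprod C s i *
     \prod_(x < n | (x \notin porbit s i) && cycmin s x) cycprod C s x).

(* column determinant cdet_j: the cycles not containing j, each ending with
   its smallest element, in decreasing order of these smallest elements,
   then the cycle of j (ending with j) *)
Definition cdet (n : nat) (C : 'M[H]_n) (j : 'I_n) : H :=
  \sum_(s : 'S_n) (-1) ^+ (n - #|porbits s|) *
    ((\prod_(x <- rev (enum 'I_n) | (x \notin porbit s j) && cycmin s x)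
        cycprod C s x) * cycprod C s j).

(* determinant of a Hermitian matrix: the (real) common value of the
   rdet_i / cdet_j, taken here as the real part of rdet_1; 1 for order 0 *)
Definition hdet (n : nat) (C : 'M[H]_n) : R :=
  if [pick i : 'I_n] is Some i then qre (rdet C i) else 1.

Definition colrep (n : nat) (C : 'M[H]_n) (j : 'I_n) (b : 'cV[H]_n) : 'M[H]_n :=
  \matrix_(a, c) if c == j then b a 0 else C a c.
Definition rowrep (n : nat) (C : 'M[H]_n) (i : 'I_n) (b : 'rV[H]_n) : 'M[H]_n :=
  \matrix_(a, c) if a == i then b 0 c else C a c.

(* principal submatrix C^S_S, S listed increasingly *)
Definition subsq (n : nat) (C : 'M[H]_n) (S : {set 'I_n}) : 'M[H]_#|S| :=
  \matrix_(a, c) C (enum_val a) (enum_val c).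

Definition cdsum (n : nat) (r : nat) (C : 'M[H]_n) (k : 'I_n) (b : 'cV[H]_n) : H :=
  \sum_(S : {set 'I_n} | (#|S| == r) && (k \in S))
     \sum_(a : 'I_#|S| | enum_val a == k) cdet (subsq (colrep C k b) S) a.

Definition rdsum (n : nat) (r : nat) (C : 'M[H]_n) (l : 'I_n) (b : 'rV[H]_n) : H :=
  \sum_(S : {set 'I_n} | (#|S| == r) && (l \in S))
     \sum_(a : 'I_#|S| | enum_val a == l) rdet (subsq (rowrep C l b) S) a.

Definition dsum (n : nat) (r : nat) (C : 'M[H]_n) : R :=
  \sum_(S : {set 'I_n} | #|S| == r) hdet (subsq C S).

End QMatrices.

Section Posdef.
Variable R : rcfType.
Definition qposdef (n : nat) (C : 'M[quat R]_n) : Prop :=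
  qhermitian C /\
  forall x : 'cV[quat R]_n, x != 0 ->
    let v := (qadj x *m C *m x) 0 0 in
    (forall k : 'I_4, k != ord0 -> v 0 k = 0) /\ 0 < v 0 ord0.
End Posdef.

(* Main.v *)
Require Import Defs.
From HB Require Import structures.
From mathcomp Require Import all_boot all_order all_fingroup all_algebra.
From mathcomp Require Import ring lra zify.
Set Implicit Arguments. Unset Strict Implicit. Unset Printing Implicit Defensive.
Import Order.TTheory GRing.Theory Num.Theory.
Local Open Scope ring_scope.

(** For a Hermitian [C], inverting a cycle of a permutation conjugates its cycle
    product, so every cycle not containing the distinguished index contributes
    only its real part to a column determinant.  Hence
    [cdet_k ((C_.k(b))^S_S) = \sum_l V_S k l * b l] with coefficients
    [V_S k l] ([minor_coef]), and cutting cycles with the transposition [(k l)]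
    gives, for [k, l] in [S], [\sum_x V_S k x * C x l = (k == l) det C^S_S] and,
    for [k != l], [V_S k l = - \sum_x V_{S \ l} k x * C x l].  Summing over
    [|S| = r], the matrices [Gamma_r] ([minor_mx]) satisfy
    [Gamma_r C + Gamma_{r+1} = Delta_r I], where [Delta_r] is the sum of the
    principal minors of order [r], and [Re tr (Gamma_r C) = r Delta_r].

    Let [r] be the largest index with [Delta_r != 0].  Since [X C C = 0] implies
    [X C = 0], the recursion yields [Gamma_r C C = Delta_r C].  For [C = K^* K]
    this produces inner inverses [Z] of [K] with [Re tr (K Z) = r].  This trace
    is the rank of [K] and is invariant under adjunction and under invertible
    factors, so [r] is the prescribed rank, and both factors of
    [X = A^+ D B^+] are read off from [Gamma_r]. *)

(** * Quaternions *)

Section Quaternions.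
Variable R : rcfType.
Local Notation H := (quat R).
Implicit Types (x y z : H) (a b : R).

Definition qi : 'I_4 := @Ordinal 4 1 isT.
Definition qj : 'I_4 := @Ordinal 4 2 isT.
Definition qk : 'I_4 := @Ordinal 4 3 isT.

Lemma quat_ext x y : x 0 ord0 = y 0 ord0 -> x 0 qi = y 0 qi ->
  x 0 qj = y 0 qj -> x 0 qk = y 0 qk -> x = y.
Proof.
move=> e0 e1 e2 e3; apply/rowP; case=> [[|[|[|[|i]]]] Hi] //.
- by rewrite (_ : Ordinal Hi = ord0) //; apply: val_inj.
- by rewrite (_ : Ordinal Hi = qi) //; apply: val_inj.
- by rewrite (_ : Ordinal Hi = qj) //; apply: val_inj.
- by rewrite (_ : Ordinal Hi = qk) //; apply: val_inj.
Qed.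

Lemma qmul_coord x y : let z := x * y in
  [/\ z 0 ord0 = x 0 ord0 * y 0 ord0 - x 0 qi * y 0 qi
                 - x 0 qj * y 0 qj - x 0 qk * y 0 qk,
      z 0 qi = x 0 ord0 * y 0 qi + x 0 qi * y 0 ord0
               + x 0 qj * y 0 qk - x 0 qk * y 0 qj,
      z 0 qj = x 0 ord0 * y 0 qj - x 0 qi * y 0 qk
               + x 0 qj * y 0 ord0 + x 0 qk * y 0 qi
    & z 0 qk = x 0 ord0 * y 0 qk + x 0 qi * y 0 qj
               - x 0 qj * y 0 qi + x 0 qk * y 0 ord0].
Proof.
have E (F : 'I_4 -> R) : \sum_(i < 4) F i = F ord0 + F qi + F qj + F qk.
  rewrite !big_ord_recr big_ord0 /= add0r.
  by congr (_ + _ + _ + _); congr F; apply: val_inj.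
rewrite /= (_ : x * y = qmul x y) //; split; rewrite mxE !E /qc /qsgn /=;
  rewrite ?mulr0z ?mulr1z ?mulrN1z; ring.
Qed.


Lemma qrealE a : [/\ qreal a 0 ord0 = a, qreal a 0 qi = 0, qreal a 0 qj = 0
  & qreal a 0 qk = 0].
Proof. by split; rewrite mxE. Qed.

Lemma qconjE x : [/\ qconj x 0 ord0 = x 0 ord0, qconj x 0 qi = - x 0 qi,
  qconj x 0 qj = - x 0 qj & qconj x 0 qk = - x 0 qk].
Proof. by split; rewrite mxE. Qed.

Lemma qconjM x y : qconj (x * y) = qconj y * qconj x.
Proof.
have [c0 c1 c2 c3] := qmul_coord x y.
have [d0 d1 d2 d3] := qmul_coord (qconj y) (qconj x).
have [x0 x1 x2 x3] := qconjE x; have [y0 y1 y2 y3] := qconjE y.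
have [z0 z1 z2 z3] := qconjE (x * y).
apply: quat_ext.
- by rewrite z0 c0 d0 x0 x1 x2 x3 y0 y1 y2 y3; ring.
- by rewrite z1 c1 d1 x0 x1 x2 x3 y0 y1 y2 y3; ring.
- by rewrite z2 c2 d2 x0 x1 x2 x3 y0 y1 y2 y3; ring.
- by rewrite z3 c3 d3 x0 x1 x2 x3 y0 y1 y2 y3; ring.
Qed.

Lemma qconjK : involutive (@qconj R).
Proof. by move=> x; apply/rowP => k; rewrite !mxE; case: eqP => _ //; rewrite opprK. Qed.

Lemma qconj_is_additive : zmod_morphism (@qconj R).
Proof. by move=> x y; apply/rowP => k; rewrite !mxE; case: eqP => _ //; rewrite opprD. Qed.
HB.instance Definition _ :=
  GRing.isZmodMorphism.Build H H (@qconj R) qconj_is_additive.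

Lemma qre_is_additive : zmod_morphism (@qre R).
Proof. by move=> x y; rewrite /qre !mxE. Qed.
HB.instance Definition _ :=
  GRing.isZmodMorphism.Build H R (@qre R) qre_is_additive.

Lemma qreal_is_additive : zmod_morphism (@qreal R).
Proof. by move=> a b; apply/rowP => k; rewrite !mxE; case: eqP => _ //; rewrite subr0. Qed.
HB.instance Definition _ :=
  GRing.isZmodMorphism.Build R H (@qreal R) qreal_is_additive.

Lemma qreal_is_monoid_morphism : monoid_morphism (@qreal R).
Proof.
split; first by apply/rowP => k; rewrite !mxE; case: (k == ord0).
move=> a b; have [c0 c1 c2 c3] := qmul_coord (qreal a) (qreal b).
have [a0 a1 a2 a3] := qrealE a; have [b0 b1 b2 b3] := qrealE b.
have [z0 z1 z2 z3] := qrealE (a * b).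
by apply: quat_ext; rewrite ?z0 ?z1 ?z2 ?z3 ?c0 ?c1 ?c2 ?c3
  a0 a1 a2 a3 b0 b1 b2 b3; ring.
Qed.
HB.instance Definition _ :=
  GRing.isMonoidMorphism.Build R H (@qreal R) qreal_is_monoid_morphism.

Lemma qrealC a x : qreal a * x = x * qreal a.
Proof.
have [c0 c1 c2 c3] := qmul_coord (qreal a) x.
have [d0 d1 d2 d3] := qmul_coord x (qreal a).
have [a0 a1 a2 a3] := qrealE a.
by apply: quat_ext; rewrite ?c0 ?c1 ?c2 ?c3 ?d0 ?d1 ?d2 ?d3 a0 a1 a2 a3; ring.
Qed.

Lemma qre_real a : qre (qreal a) = a.
Proof. by rewrite /qre mxE. Qed.

Lemma qre_conj x : qre (qconj x) = qre x.
Proof. by rewrite /qre mxE. Qed.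

Lemma qconj_real a : qconj (qreal a) = qreal a.
Proof. by apply/rowP => k; rewrite !mxE; case: eqP => _ //; rewrite oppr0. Qed.

Lemma qreM_real a x : qre (qreal a * x) = a * qre x.
Proof.
have [c0 _ _ _] := qmul_coord (qreal a) x; have [a0 a1 a2 a3] := qrealE a.
by rewrite /qre c0 a0 a1 a2 a3; ring.
Qed.

Lemma qreMC x y : qre (x * y) = qre (y * x).
Proof.
have [c0 _ _ _] := qmul_coord x y; have [d0 _ _ _] := qmul_coord y x.
by rewrite /qre c0 d0; ring.
Qed.

Lemma qaddconj x : x + qconj x = qreal (qre x) + qreal (qre x).
Proof. by apply/rowP => k; rewrite !mxE /qre; case: eqP => [->|_]; rewrite ?subrr ?addr0. Qed.

Lemma qmulconj_ge0 x : 0 <= qre (x * qconj x).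
Proof.
have [c0 _ _ _] := qmul_coord x (qconj x); have [x0 x1 x2 x3] := qconjE x.
by rewrite /qre c0 x0 x1 x2 x3; nra.
Qed.

Lemma qmulconj_eq0 x : qre (x * qconj x) = 0 -> x = 0.
Proof.
have [c0 _ _ _] := qmul_coord x (qconj x); have [x0 x1 x2 x3] := qconjE x.
rewrite /qre c0 x0 x1 x2 x3 !mulrN !opprK -!expr2 => e.
have := (sqr_ge0 (x 0 ord0), sqr_ge0 (x 0 qi), sqr_ge0 (x 0 qj), sqr_ge0 (x 0 qk)).
case=> [[[h0 h1] h2] h3].
by apply: quat_ext; rewrite mxE; apply/eqP; rewrite -sqrf_eq0; apply/eqP; lra.
Qed.

Lemma qmulconj_real x : x * qconj x = qreal (qre (x * qconj x)).
Proof.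
have [c0 c1 c2 c3] := qmul_coord x (qconj x); have [x0 x1 x2 x3] := qconjE x.
have [z0 z1 z2 z3] := qrealE (qre (x * qconj x)).
apply: quat_ext.
- by rewrite z0.
- by rewrite z1 c1 x0 x1 x2 x3; ring.
- by rewrite z2 c2 x0 x1 x2 x3; ring.
- by rewrite z3 c3 x0 x1 x2 x3; ring.
Qed.

(** Division: [qconj x], divided by the nonzero real number [x * qconj x], inverts [x]. *)
Lemma qmulf_eq0 x y : x * y = 0 -> x != 0 -> y = 0.
Proof.
move=> xy0 nx; have /eqP : qre (qconj x * qconj (qconj x)) != 0.
  apply/eqP => /qmulconj_eq0 /(congr1 (@qconj R)); rewrite qconjK raddf0 => x0.
  by rewrite x0 eqxx in nx.
set c := qre _ => /eqP c0.
have: qreal (c^-1) * (qconj x * (x * y)) = y.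
  by rewrite (mulrA (qconj x)) -{2}(qconjK x) qmulconj_real mulrA -rmorphM mulVf // rmorph1 mul1r.
by rewrite xy0 !mulr0.
Qed.

Lemma qopp_eq0 x : x = - x -> x = 0.
Proof.
move=> /rowP e; apply/rowP => k; have := e k; rewrite !mxE => e'; lra.
Qed.

End Quaternions.

(** * Cycles of permutations *)

Section PermutationCycles.
Variable T : finType.
Implicit Types (s u : {perm T}) (x y k l : T).

Lemma perm_onT s : perm_on setT s.
Proof. by apply/subsetP => x _; rewrite inE. Qed.

Lemma permXSr s x t : (s ^+ t.+1)%g x = s ((s ^+ t)%g x).
Proof. by rewrite expgSr permM. Qed.

Lemma expg_porbit_eq s u x : {in porbit s x, s =1 u} ->
  forall t, (u ^+ t)%g x = (s ^+ t)%g x.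
Proof.
move=> e; elim=> [|t IH]; first by rewrite !expg0.
by rewrite !permXSr IH e ?mem_porbit.
Qed.

Lemma porbit_eq s u x : {in porbit s x, s =1 u} -> porbit u x = porbit s x.
Proof.
move=> /expg_porbit_eq e; apply/setP => y.
by apply/porbitP/porbitP => -[i ->]; exists i.
Qed.

Lemma mem_porbit_perm s x y : (s y \in porbit s x) = (y \in porbit s x).
Proof.
by have := porbit_perm s 1 y; rewrite expg1 -!eq_porbit_mem => ->.
Qed.

Lemma expg_porbit s x : (s ^+ #|porbit s x|)%g x = x.
Proof. by rewrite permX iter_porbit. Qed.

Lemma expg_porbit_inj s x (t u : nat) :
  (t < #|porbit s x|)%N -> (u < #|porbit s x|)%N ->
  (s ^+ t)%g x = (s ^+ u)%g x -> t = u.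
Proof.
move=> ht hu; rewrite !permX => e; apply/eqP.
have U := uniq_traject_porbit s x.
by rewrite -(nth_uniq x _ _ U) ?size_traject // !nth_traject // e.
Qed.

Lemma card_porbitP s x N : (0 < N)%N -> (s ^+ N)%g x = x ->
  (forall t, (0 < t < N)%N -> (s ^+ t)%g x != x) -> #|porbit s x| = N.
Proof.
move=> N0 sN ne; set M := #|porbit s x|.
have M0 : (0 < M)%N by rewrite lt0n card_porbit_neq0.
have [lt|lt|//] := ltngtP M N.
  by have := ne M; rewrite M0 lt expg_porbit eqxx => /(_ isT).
have := @expg_porbit_inj s x N 0 lt M0; rewrite sN expg0 perm1 => /(_ erefl) N1.
by rewrite N1 in N0.
Qed.

Lemma porbit_mem s x y : y \in porbit s x ->
  exists2 t, (t < #|porbit s x|)%N & y = (s ^+ t)%g x.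
Proof.
by rewrite porbit_traject => /trajectP[t lt ->]; exists t; rewrite ?permX.
Qed.

(** Inverting the one cycle through [x] keeps every cycle as a set, hence the sign and the cycle
    minima. This involution is behind every reduction of a cycle product to its real part. *)
Definition flip_cycle_fun s x y := if y \in porbit s x then s^-1%g y else s y.

Lemma flip_cycle_inj s x : injective (flip_cycle_fun s x).
Proof.
move=> y z; rewrite /flip_cycle_fun.
have hV w : (s^-1%g w \in porbit s x) = (w \in porbit s x).
  by rewrite -{1}porbitV mem_porbit_perm porbitV.
case: ifP => hy; case: ifP => hz; try exact: perm_inj.
- by move=> e; move: hy; rewrite -hV e mem_porbit_perm hz.
- by move=> e; move: hz; rewrite -hV -e mem_porbit_perm hy.
Qed.

Definition flip_cycle s x : {perm T} := perm (@flip_cycle_inj s x).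

Lemma flip_cycleE s x y :
  flip_cycle s x y = if y \in porbit s x then s^-1%g y else s y.
Proof. by rewrite permE. Qed.

Lemma flip_cycle_in s x y : y \in porbit s x ->
  {in porbit s^-1 y, s^-1%g =1 flip_cycle s x}.
Proof.
move=> hy z; rewrite porbitV flip_cycleE => hz.
suff -> : z \in porbit s x by [].
by move: hz; rewrite -!eq_porbit_mem => /eqP ->; rewrite eq_porbit_mem.
Qed.

Lemma flip_cycle_out s x y : y \notin porbit s x ->
  {in porbit s y, s =1 flip_cycle s x}.
Proof.
move=> hy z hz; rewrite flip_cycleE ifN //; apply: contra hy.
by move: hz; rewrite -!eq_porbit_mem => /eqP ->.
Qed.

Lemma porbit_flip_cycle s x y : porbit (flip_cycle s x) y = porbit s y.
Proof.
have [hy|hy] := boolP (y \in porbit s x).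
  by rewrite (porbit_eq (flip_cycle_in hy)) porbitV.
exact: porbit_eq (flip_cycle_out hy).
Qed.

Lemma porbits_flip_cycle s x : porbits (flip_cycle s x) = porbits s.
Proof. by apply: eq_imset => y; rewrite porbit_flip_cycle. Qed.

Lemma flip_cycleK x : involutive (fun s => flip_cycle s x).
Proof.
move=> s; apply/permP => y; rewrite flip_cycleE porbit_flip_cycle.
case: ifP => hy; last by rewrite flip_cycleE hy.
apply: (canLR (permK _)); rewrite flip_cycleE mem_porbit_perm hy.
by rewrite permK.
Qed.

Lemma odd_flip_cycle s x : odd_perm (flip_cycle s x) = odd_perm s.
Proof. by rewrite /odd_perm porbits_flip_cycle. Qed.

Lemma perm_on_flip_cycle (S : {set T}) s x :
  perm_on S (flip_cycle s x) = perm_on S s.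
Proof.
apply: eq_subset => y; rewrite !inE flip_cycleE; case: ifP => // _.
by rewrite -(inj_eq (@perm_inj _ s)) permKV eq_sym.
Qed.

(** * Cutting a cycle by a transposition *)

Section Cut.
Variables (s : {perm T}) (k l : T).
Hypotheses (kl : k != l) (l_in : l \in porbit s k).
Let u := (s * tperm k l)%g.

(** The transposition acts after [s] and changes only the images [l] and [k]: with [l = s^a k], the
    point [s^(a-1) k] now returns to [k], and the last point of the old cycle returns to [l]. Both
    pieces are traversed as in [s]. *)
Lemma cut_cycle : exists a, [/\ (0 < a < #|porbit s k|)%N, l = (s ^+ a)%g k,
  #|porbit u k| = a, #|porbit u l| = (#|porbit s k| - a)%N &
  (forall t, (t < a)%N -> (u ^+ t)%g k = (s ^+ t)%g k) /\
  (forall t, (t < #|porbit s k| - a)%N -> (u ^+ t)%g l = (s ^+ (a + t))%g k)].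
Proof.
have [a aN la] := porbit_mem l_in; exists a; set N := #|porbit s k| in aN *.
have a0 : (0 < a)%N.
  by rewrite lt0n; apply: contraNneq kl => a0; rewrite la a0 expg0 perm1.
have ne t v : (t < N)%N -> (v < N)%N -> t != v ->
    (s ^+ t)%g k != (s ^+ v)%g k.
  by move=> ht hu; apply: contraNneq => /expg_porbit_inj -> //.
have ne0 t : (0 < t < N)%N -> k != (s ^+ t)%g k.
  by move=> /andP[t0 tN]; rewrite -{1}[k](perm1 (T := T)) -(expg0 s) ne //; lia.
have hk t : (t < a)%N -> (u ^+ t)%g k = (s ^+ t)%g k.
  elim: t => [|t IH] ht; first by rewrite !expg0.
  rewrite permXSr IH ?(ltnW ht) // permM -permXSr tpermD //.
    by rewrite ne0 //; lia.
  by rewrite la ne //; lia.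
have hl t : (t < N - a)%N -> (u ^+ t)%g l = (s ^+ (a + t))%g k.
  elim: t => [|t IH] ht; first by rewrite addn0 expg0 perm1.
  rewrite addnS permXSr IH ?(ltnW ht) // permM -permXSr tpermD //.
    by rewrite ne0 //; lia.
  by rewrite la ne //; lia.
split => //; first by rewrite a0.
  apply: card_porbitP => //.
    rewrite -(prednK a0) permXSr hk ?ltn_predL // permM -permXSr prednK //.
    by rewrite -la tpermR.
  by move=> t /andP[t0 ta]; rewrite hk // eq_sym ne0 //; lia.
apply: card_porbitP; first by lia.
  have Na : (0 < N - a)%N by lia.
  rewrite -(prednK Na) permXSr hl ?ltn_predL // permM -permXSr.
  have -> : (a + (N - a).-1).+1 = N by lia.
  by rewrite expg_porbit tpermL.
by move=> t /andP[t0 ta]; rewrite hl // la ne //; lia.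
Qed.

Lemma notin_porbit_cut : l \notin porbit u k.
Proof.
have [a [/andP[a0 aN] la ka _ [hk _]]] := cut_cycle.
apply/negP => /porbit_mem[t]; rewrite ka => ta; rewrite hk // la.
by move=> e; have := expg_porbit_inj aN (ltn_trans ta aN) e; lia.
Qed.

Lemma porbit_cut : porbit s k = porbit u k :|: porbit u l.
Proof.
have [a [/andP[a0 aN] la ka lb [hk hl]]] := cut_cycle.
apply/setP => y; rewrite inE; apply/idP/orP => [/porbit_mem[t tN ->]|[]].
- have [ta|ta] := ltnP t a; first by left; rewrite -hk // mem_porbit.
  by right; rewrite -(subnKC ta) -hl ?mem_porbit // ltn_sub2r.
- by move=> /porbit_mem[t]; rewrite ka => ta ->; rewrite hk // mem_porbit.
- by move=> /porbit_mem[t]; rewrite lb => ta ->; rewrite hl // mem_porbit.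
Qed.

Lemma cut_out y : y \notin porbit s k -> {in porbit s y, s =1 u}.
Proof.
move=> hy z hz; rewrite permM tpermD //.
  apply: contraNneq hy => e; move: hz; rewrite -(mem_porbit_perm s) -e.
  by rewrite porbit_sym.
apply: contraNneq hy => e; move: hz; rewrite -(mem_porbit_perm s) -e.
by rewrite porbit_sym; move: l_in; rewrite -!eq_porbit_mem => /eqP ->.
Qed.

Lemma cut_invl : (u^-1)%g l = (s^-1)%g k.
Proof. by apply: (canLR (permK _)); rewrite permM permKV tpermL. Qed.

End Cut.

(** Otherwise two successive multiplications by [(k l)] would each lower the number of cycles,
    although together they give back [s]. Passing to inverses, which have the same cycles as sets,
    puts the transposition on the left, where the counting lemma wants it. *)
Lemma in_porbit_join s k l : k != l -> l \notin porbit s k ->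
  l \in porbit (s * tperm k l)%g k.
Proof.
move=> kl hl; apply/negPn/negP => hl'.
have := porbits_mul_tperm (s^-1)%g k l; have := porbits_mul_tperm ((s * tperm k l)^-1)%g k l.
rewrite /= -{1 5}(tpermV k l) -!invMg -mulgA tperm2 mulg1 !porbitsV !porbitV.
by rewrite !(porbit_sym _ k) hl hl' kl; lia.
Qed.

End PermutationCycles.

(** * Cycle products *)

Section CycleProducts.
Variables (R : rcfType) (n : nat).
Local Notation H := (quat R).
Implicit Types (C : 'M[H]_n) (s u : 'S_n) (S : {set 'I_n}) (x y k l : 'I_n).

Lemma prod_ord_recr (F : nat -> H) N : (0 < N)%N ->
  \prod_(t < N) F t = \prod_(t < N.-1) F t * F N.-1.
Proof. by case: N => // N _; rewrite big_ord_recr. Qed.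

Lemma prod_ord_recl (F : nat -> H) N : (0 < N)%N ->
  \prod_(t < N) F t = F 0 * \prod_(t < N.-1) F t.+1.
Proof. by case: N => // N _; rewrite big_ord_recl. Qed.

(** The cycle product at [x] without its closing factor. That factor is the only one in column [x],
    hence the only one changed when column [x] is replaced. *)
Definition cycpath C s x : H :=
  \prod_(t < #|porbit s x|.-1) C ((s ^+ t)%g x) ((s ^+ t.+1)%g x).

Lemma cycprod_path C s x : cycprod C s x = cycpath C s x * C (s^-1%g x) x.
Proof.
have N0 : (0 < #|porbit s x|)%N by rewrite lt0n card_porbit_neq0.
rewrite /cycprod /cycpath.
rewrite (prod_ord_recr (fun t => C ((s ^+ t)%g x) ((s ^+ t.+1)%g x)) N0).
rewrite (prednK N0) expg_porbit; congr (_ * C _ _).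
by apply: (canRL (permK _)); rewrite -permXSr prednK // expg_porbit.
Qed.

Lemma eq_cycprod C s u x : {in porbit s x, s =1 u} ->
  cycprod C u x = cycprod C s x.
Proof.
move=> e; rewrite /cycprod (porbit_eq e); apply: eq_bigr => t _.
by rewrite !(expg_porbit_eq e).
Qed.

Lemma eq_cycpath C s u x : {in porbit s x, s =1 u} ->
  cycpath C u x = cycpath C s x.
Proof.
move=> e; rewrite /cycpath (porbit_eq e); apply: eq_bigr => t _.
by rewrite !(expg_porbit_eq e).
Qed.

Lemma qconj_prod N (F : nat -> H) :
  qconj (\prod_(t < N) F t) = \prod_(t < N) qconj (F (N - t.+1)%N).
Proof.
elim: N => [|N IH].
  by rewrite !big_ord0 -(rmorph1 (@qreal R)) qconj_real.
rewrite big_ord_recr big_ord_recl /= qconjM IH subSS subn0.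
by congr (_ * _); apply: eq_bigr => t _; rewrite lift0 subSS.
Qed.

Lemma cycprodV C s x : cycprod (qadj C) s^-1 x = qconj (cycprod C s x).
Proof.
rewrite /cycprod porbitV (qconj_prod _ (fun t => C ((s ^+ t)%g x) ((s ^+ t.+1)%g x))).
set N := #|_|; apply: eq_bigr => t _.
have E (v : nat) : (v <= N)%N -> ((s^-1) ^+ v)%g x = (s ^+ (N - v))%g x.
  move=> vN; rewrite expgVn; apply: (canLR (permK _)).
  by rewrite -permM -expgD subnK // expg_porbit.
by rewrite mxE !E ?(ltnW (ltn_ord t)) // subnSK.
Qed.

(** Moving the starting point rotates the product cyclically, and [qre] is invariant under rotation
    by [qreMC]. *)
Lemma qre_cycprod_perm C s x : qre (cycprod C s (s x)) = qre (cycprod C s x).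
Proof.
have N0 : (0 < #|porbit s x|)%N by rewrite lt0n card_porbit_neq0.
have e : porbit s (s x) = porbit s x by have := porbit_perm s 1 x; rewrite expg1.
have ex t : (s ^+ t)%g (s x) = (s ^+ t.+1)%g x by rewrite expgS permM.
pose F t := C ((s ^+ t)%g x) ((s ^+ t.+1)%g x).
transitivity (qre (\prod_(t < #|porbit s x|) F t.+1)).
  by rewrite /cycprod e; congr qre; apply: eq_bigr => t _; rewrite !ex.
rewrite (prod_ord_recr (fun t => F t.+1) N0) qreMC (prednK N0).
rewrite /cycprod [in RHS](prod_ord_recl F N0); congr (qre (_ * _)).
by rewrite /F permXSr expg_porbit expg0 perm1 expg1.
Qed.

Lemma qre_cycprod C s x y : y \in porbit s x ->
  qre (cycprod C s y) = qre (cycprod C s x).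
Proof.
move=> /porbitP[t ->]; elim: t => [|t IH]; first by rewrite expg0 perm1.
by rewrite permXSr qre_cycprod_perm.
Qed.

(** The real part of a cycle product as a function of the cycle as a set: by [qre_cycprod] the point
    picked does not matter. The value 1 is a dummy for the empty set, which is not a cycle. *)
Definition cycre C s (o : {set 'I_n}) : R :=
  if [pick x in o] is Some x then qre (cycprod C s x) else 1.

Lemma cycreE C s x : cycre C s (porbit s x) = qre (cycprod C s x).
Proof.
rewrite /cycre; case: pickP => [y hy|/(_ x)]; first exact: qre_cycprod.
by rewrite porbit_id.
Qed.

Lemma eq_cycre C s u x : {in porbit s x, s =1 u} ->
  cycre C u (porbit s x) = cycre C s (porbit s x).
Proof.
by move=> e; rewrite -{1}(porbit_eq e) !cycreE (eq_cycprod _ e).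
Qed.

(** The path from [k] runs through the first piece, enters [l] from [s^-1 l = u^-1 k], and continues
    along the second piece, whose closing factor is missing as well. *)
Lemma cycpath_cut C s k l : k != l -> l \in porbit s k ->
  let u := (s * tperm k l)%g in
  cycpath C s k = cycpath C u k * C (u^-1%g k) l * cycpath C u l.
Proof.
move=> kl hl u; have [a [/andP[a0 aN] la ka lb [hk hu]]] := cut_cycle kl hl.
rewrite /cycpath ka lb; set N := #|porbit s k| in aN lb hu *.
rewrite -(big_mkord xpredT (fun t => C ((s ^+ t)%g k) ((s ^+ t.+1)%g k))).
rewrite (@big_cat_nat _ _ _ a.-1) //=; last by lia.
rewrite (@big_cat_nat _ _ _ a a.-1) //=; try lia.
rewrite [LHS]mulrA; congr (_ * _ * _).
- rewrite big_mkord; apply: eq_bigr => t _.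
  by rewrite !hk //; have := ltn_ord t; lia.
- rewrite -{2}(prednK a0) big_nat1 prednK // la; congr (C _ _).
  rewrite -hk ?ltn_predL //; apply: (canRL (permK _)).
  by rewrite -permXSr prednK // -ka expg_porbit.
- rewrite -{1}(add0n a) big_addn big_mkord.
  have -> : (N.-1 - a = (N - a).-1)%N by lia.
  apply: eq_bigr => t _; have := ltn_ord t => ht.
  by rewrite !hu; [rewrite addnS addnC|lia|lia].
Qed.

Lemma cycpath_fix C s k : s k = k -> cycpath C s k = 1.
Proof.
move=> sk; rewrite /cycpath (_ : #|porbit s k| = 1%N) ?big_ord0 //.
by apply: card_porbitP; rewrite ?expg1 // => t; lia.
Qed.

Section Hermitian.
Variable C : 'M[H]_n.
Hypothesis hC : qhermitian C.

Lemma cycprod_rev s x : cycprod C (flip_cycle s x) x = qconj (cycprod C s x).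
Proof.
by rewrite (eq_cycprod _ (flip_cycle_in (porbit_id s x))) -{1}hC cycprodV.
Qed.

Lemma cycre_rev s x o : o \in porbits s ->
  cycre C (flip_cycle s x) o = cycre C s o.
Proof.
move=> /imsetP[y _ ->]; rewrite -{1}(porbit_flip_cycle s x) !cycreE.
have [hy|hy] := boolP (y \in porbit s x); last first.
  by rewrite (eq_cycprod _ (flip_cycle_out hy)).
by rewrite (eq_cycprod _ (flip_cycle_in hy)) -{1}hC cycprodV qre_conj.
Qed.

(** Reindexing by [flip_cycle] conjugates the middle factor and fixes the outer ones, so the
    difference of the two sides equals its own negative. *)
Lemma sum_cycprod_re (P : pred 'S_n) (F G : 'S_n -> H) x :
  (forall s, P (flip_cycle s x) = P s) ->
  (forall s, P s -> F (flip_cycle s x) = F s) ->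
  (forall s, P s -> G (flip_cycle s x) = G s) ->
  \sum_(s | P s) F s * cycprod C s x * G s =
  \sum_(s | P s) F s * qreal (qre (cycprod C s x)) * G s.
Proof.
move=> hP hF hG; apply/eqP; rewrite -subr_eq0 -sumrB; apply/eqP.
apply: qopp_eq0; rewrite {1}(reindex_inj (inv_inj (@flip_cycleK _ x))) /= -sumrN.
rewrite (eq_bigl _ _ hP); apply: eq_bigr => s Ps.
rewrite hF // hG // cycprod_rev qre_conj -!mulrBl -!mulrBr -mulNr -mulrN opprB.
congr (_ * _ * _); apply/eqP; rewrite subr_eq addrAC -subr_eq opprK.
by rewrite addrC qaddconj.
Qed.

End Hermitian.
End CycleProducts.

(** * Principal minors and their column coefficients *)

Section PrincipalMinors.
Variables (R : rcfType) (n : nat).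
Local Notation H := (quat R).
Implicit Types (C : 'M[H]_n) (s u : 'S_n) (S : {set 'I_n}) (x y k l : 'I_n).

(** The condition [o \subset S] discards the fixed points outside [S], which would otherwise
    contribute diagonal entries of [C]. *)
Definition cycrest C S k s : R :=
  \prod_(o in porbits s | (o \subset S) && (k \notin o)) cycre C s o.

(** For Hermitian [C] and [k] in [S], this is the coefficient of [b l] in the column determinant of
    the submatrix on [S] with column [k] replaced by [b]. The condition [s l == k] selects the
    permutations whose factor in column [k] lies in row [l]. *)
Definition minor_coef C S k l : H :=
  \sum_(s : 'S_n | perm_on S s && (s l == k))
    qreal ((-1) ^+ s * cycrest C S k s) * cycpath C s k.

(** For Hermitian [C] this is the determinant of the principal submatrix on [S], by [hdet_minor] and
    [minor_sub]. Being a sum of products of reals, it needs no order on the cycles. *)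
Definition minor C S : R :=
  \sum_(s : 'S_n | perm_on S s)
    (-1) ^+ s * \prod_(o in porbits s | o \subset S) cycre C s o.

Lemma minor_coef_sum C S k (f : 'I_n -> H) :
  \sum_x minor_coef C S k x * f x =
  \sum_(s : 'S_n | perm_on S s)
    qreal ((-1) ^+ s * cycrest C S k s) * cycpath C s k * f (s^-1%g k).
Proof.
rewrite (partition_big (fun s : 'S_n => s^-1%g k) xpredT) //=.
apply: eq_bigr => x _; rewrite /minor_coef mulr_suml.
have e s : (s x == k) = (s^-1%g k == x).
  by rewrite -(inj_eq (@perm_inj _ s) _ x) permKV eq_sym.
by apply: eq_big => [s|s]; rewrite e // => /andP[_ /eqP ->].
Qed.

Lemma porbit_subset S s k : perm_on S s -> k \in S -> porbit s k \subset S.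
Proof.
move=> sS kS; apply/subsetP => _ /porbitP[t ->].
by elim: t => [|t IH]; rewrite ?expg0 ?perm1 // permXSr perm_closed.
Qed.

Lemma mem_porbits s o k : o \in porbits s -> (k \in o) = (o == porbit s k).
Proof.
by move=> /imsetP[y _ ->]; rewrite eq_porbit_mem porbit_sym.
Qed.

Lemma porbits_prodD1 (P : pred {set 'I_n}) C s k : P (porbit s k) ->
  \prod_(o in porbits s | P o) cycre C s o =
  qre (cycprod C s k) * \prod_(o in porbits s | P o && (k \notin o)) cycre C s o.
Proof.
move=> Pk; rewrite (bigD1 (porbit s k)) /=; last by rewrite imset_f.
rewrite cycreE; congr (_ * _); apply: eq_bigl => o.
by case ho: (o \in porbits s) => //=; rewrite (mem_porbits k ho).
Qed.

(** The cycles of [s] other than that of [k] are exactly the cycles of [u] that avoid both [k] and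
    [l], and [s] and [u] agree on them. *)
Lemma cycrest_cut C S s k l : k != l -> l \in porbit s k ->
  let u := (s * tperm k l)%g in
  cycrest C S k s = \prod_(o in porbits u | [&& o \subset S, k \notin o & l \notin o])
    cycre C u o.
Proof.
move=> kl hl u.
have e y : y \notin porbit s k -> porbit u y = porbit s y.
  by move=> hy; apply: porbit_eq; exact: cut_out.
have sl : porbit s l = porbit s k by apply/eqP; rewrite eq_porbit_mem.
rewrite /cycrest; apply: eq_big => [o|o /and3P[/imsetP[y _ ->] _ hk]]; last first.
  by apply/esym/eq_cycre/cut_out => //; rewrite porbit_sym.
case oS: (o \subset S) => /=; last by rewrite !andbF.
apply/andP/and3P => [[/imsetP[y _ ->] hk]|[/imsetP[y _ ->] hk hl']].
  have hy : y \notin porbit s k by rewrite porbit_sym.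
  rewrite -(e _ hy) imset_f // (e _ hy) hk porbit_sym sl hy; split=> //.
have hy : y \notin porbit s k.
  by rewrite (porbit_cut kl hl) inE negb_or !(porbit_sym _ y) hk.
by rewrite e // imset_f // -e.
Qed.

(** Permutations of [S] fixing [k] are those of [S :\ k], and the path at a fixed point is an empty
    product. *)
Lemma minor_coef_diag C S k : k \in S ->
  minor_coef C S k k = qreal (minor C (S :\ k)).
Proof.
move=> kS; rewrite /minor_coef /minor rmorph_sum /=.
have e s : (perm_on S s && (s k == k)) = perm_on (S :\ k) s.
  apply/andP/idP => [[sS /eqP sk]|sS].
    apply/subsetP => x; rewrite !inE => sx; apply/andP; split.
      by apply: contraNneq sx => ->; rewrite sk.
    by apply: (subsetP sS); rewrite inE.
  split; last by rewrite (out_perm sS) // !inE eqxx.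
  by apply: subset_trans sS _; rewrite subD1set.
apply: eq_big => // s; rewrite e => sS.
rewrite cycpath_fix ?mulr1; last by rewrite (out_perm sS) // !inE eqxx.
by congr (qreal (_ * _)); apply: eq_bigl => o; rewrite subsetD1.
Qed.

Lemma minor_coef_out C S k l : k \in S -> l \notin S -> minor_coef C S k l = 0.
Proof.
move=> kS lS; apply: big1 => s /andP[sS /eqP sl].
by case/negP: lS; rewrite -(perm_closed _ sS) sl.
Qed.

(** Multiplication by [(k l)] matches the permutations of [S] sending [l] to [k] with the
    permutations of [S :\ l]. It costs a sign and cuts off [l] as a fixed point, which leaves a path
    at [k] followed by an entry of column [l]. *)
Lemma minor_coef_offdiag C S k l : k \in S -> l \in S -> k != l ->
  minor_coef C S k l = - \sum_x minor_coef C (S :\ l) k x * C x l.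
Proof.
move=> kS lS kl; rewrite minor_coef_sum -sumrN /minor_coef.
have tt : involutive (fun s : 'S_n => (s * tperm k l)%g).
  by move=> s; rewrite -mulgA tperm2 mulg1.
have tS : perm_on S (tperm k l).
  by apply: subset_trans (tperm_on k l) _; apply/subsetP => x /set2P[] ->.
rewrite (reindex_inj (inv_inj tt)) /=.
have e s : (perm_on S (s * tperm k l)%g && ((s * tperm k l)%g l == k)) =
    perm_on (S :\ l) s.
  apply/andP/idP => [[sS]|sS].
    rewrite permM -(inj_eq (@perm_inj _ (tperm k l))) tpermK tpermL => /eqP sl.
    have sS' : perm_on S s by rewrite -(tt s); apply: perm_onM.
    apply/subsetP => x; rewrite !inE => sx; apply/andP; split.
      by apply: contraNneq sx => ->; rewrite sl.
    by apply: (subsetP sS'); rewrite inE.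
  have sl : s l = l by rewrite (out_perm sS) // !inE eqxx.
  split; last by rewrite permM sl tpermR.
  by apply: perm_onM => //; apply: subset_trans sS _; rewrite subD1set.
apply: eq_big => // s; rewrite e => sS.
have sl : s l = l by rewrite (out_perm sS) // !inE eqxx.
have hl : l \in porbit (s * tperm k l)%g k.
  have := mem_porbit (s * tperm k l)%g 1 l.
  by rewrite expg1 {1}permM sl tpermR porbit_sym.
rewrite (cycpath_cut C kl hl) (cycrest_cut C S kl hl) !tt.
rewrite (cycpath_fix C sl) mulr1 odd_permM odd_tperm kl signr_addb mulrN1.
rewrite mulNr raddfN mulNr mulrA; congr (- (qreal (_ * _) * _ * _)).
by apply: eq_bigl => o; rewrite subsetD1 -andbA (andbC (k \notin _)).
Qed.

Section Hermitian.
Variable C : 'M[H]_n.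
Hypothesis hC : qhermitian C.

Lemma prod_cycre_flip (P : pred {set 'I_n}) s x :
  \prod_(o in porbits (flip_cycle s x) | P o) cycre C (flip_cycle s x) o =
  \prod_(o in porbits s | P o) cycre C s o.
Proof.
by rewrite porbits_flip_cycle; apply: eq_bigr => o /andP[ho _]; apply: cycre_rev.
Qed.

(** With column [k] back in place the path closes to a full cycle product, and inverting that cycle
    leaves only its real part. *)
Lemma minor_expand S k : k \in S ->
  \sum_x minor_coef C S k x * C x k = qreal (minor C S).
Proof.
move=> kS; rewrite minor_coef_sum /minor rmorph_sum /=.
rewrite (eq_bigr (fun s : 'S_n =>
    qreal ((-1) ^+ s * cycrest C S k s) * cycprod C s k * 1)); last first.
  by move=> s _; rewrite mulr1 cycprod_path mulrA.
rewrite sum_cycprod_re // => [|s|s _]; rewrite ?perm_on_flip_cycle //; last first.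
  by rewrite odd_flip_cycle /cycrest prod_cycre_flip.
apply: eq_bigr => s sS; rewrite mulr1 -rmorphM -mulrA; congr (qreal (_ * _)).
by rewrite mulrC -(porbits_prodD1 (P := fun o => o \subset S)) ?porbit_subset.
Qed.

(** The transposition [(k l)] exchanges the permutations having [k] and [l] in one cycle with those
    having them in different cycles. The signs are opposite, and the terms agree once the separate
    cycle through [l] is reduced to its real part. *)
Lemma minor_expand_alien S k l : k \in S -> l \in S -> k != l ->
  \sum_x minor_coef C S k x * C x l = 0.
Proof.
move=> kS lS kl; rewrite minor_coef_sum.
have tt : involutive (fun s : 'S_n => (s * tperm k l)%g).
  by move=> s; rewrite -mulgA tperm2 mulg1.
have tS : perm_on S (tperm k l).
  by apply: subset_trans (tperm_on k l) _; apply/subsetP => x /set2P[] ->.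
rewrite (bigID (fun s : 'S_n => l \in porbit s k)) /=.
rewrite (reindex_inj (inv_inj tt)) /=.
have e s : (perm_on S (s * tperm k l)%g && (l \in porbit (s * tperm k l)%g k)) =
    (perm_on S s && (l \notin porbit s k)).
  congr andb.
    by apply/idP/idP => h; [rewrite -(tt s)|]; apply: perm_onM.
  apply/idP/idP => h; last exact: in_porbit_join.
  by rewrite -(tt s); apply: notin_porbit_cut.
rewrite (eq_bigl _ _ e) {e}.
pose F s : H := qreal ((-1) ^+ s *
  \prod_(o in porbits s | [&& o \subset S, k \notin o & l \notin o]) cycre C s o)
  * (cycpath C s k * C (s^-1%g k) l).
rewrite (eq_bigr (fun s => - (F s * cycprod C s l * 1))); last first.
  move=> s /andP[sS hl]; have hl' := in_porbit_join kl hl.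
  have iv : ((s * tperm k l)^-1)%g k = (s^-1)%g l by rewrite -(cut_invl _ k l) tt.
  rewrite (cycpath_cut C kl hl') (cycrest_cut C S kl hl') iv !tt cycprod_path mulr1.
  rewrite odd_permM odd_tperm kl signr_addb mulrN1 mulNr raddfN !mulNr.
  by rewrite /F !mulrA.
(* The second piece of the joined cycle is a full cycle product at [l] of the split permutation.
   Inverting it changes neither the path at [k] nor the predecessor of [k], so only its real part
   survives. *)
rewrite sumrN sum_cycprod_re //; last first.
- move=> s /andP[_ hl]; rewrite /F odd_flip_cycle prod_cycre_flip.
  have hk : k \notin porbit s l by rewrite porbit_sym.
  rewrite (eq_cycpath _ (flip_cycle_out hk)); congr (_ * (_ * C _ _)).
  apply: (canLR (permK _)).
  rewrite -(flip_cycle_out hk) ?permKV //.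
  by rewrite -mem_porbit_perm permKV porbit_id.
- by move=> s; rewrite perm_on_flip_cycle porbit_flip_cycle.
apply/eqP; rewrite addrC subr_eq0; apply/eqP; apply: eq_bigr => s /andP[sS hl].
rewrite /F mulr1 /cycrest.
rewrite (@porbits_prodD1 (fun o => (o \subset S) && (k \notin o)) C s l); last first.
  by rewrite porbit_subset //= porbit_sym.
rewrite -[RHS]qrealC mulrA -rmorphM -mulrA; congr (qreal _ * _).
rewrite mulrCA; congr (_ * (_ * _)).
by apply: eq_bigl => o; rewrite -!andbA.
Qed.

End Hermitian.
End PrincipalMinors.

(** * Row and column determinants *)

Section ColumnDeterminant.
Variables (R : rcfType) (n : nat).
Local Notation H := (quat R).
Implicit Types (C : 'M[H]_n) (s u : 'S_n) (S : {set 'I_n}) (x y j k l : 'I_n).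

Lemma sign_porbits (A : nzRingType) s :
  (-1) ^+ (n - #|porbits s|) = (-1) ^+ s :> A.
Proof.
have le : (#|porbits s| <= n)%N.
  by rewrite -[X in (_ <= X)%N]card_ord leq_imset_card.
by rewrite -signr_odd oddB // /odd_perm card_ord.
Qed.

Lemma cycprod_colrep_out C j b s x : x \notin porbit s j ->
  cycprod (colrep C j b) s x = cycprod C s x.
Proof.
move=> hx; apply: eq_bigr => t _; rewrite mxE ifN //.
by apply: contraNneq hx => <-; rewrite porbit_sym mem_porbit.
Qed.

Lemma cycprod_colrep C j b s :
  cycprod (colrep C j b) s j = cycpath C s j * b (s^-1%g j) 0.
Proof.
rewrite cycprod_path mxE eqxx; congr (_ * _); apply: eq_bigr => t _.
rewrite mxE ifN //; apply/eqP => e.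
have ht : (t.+1 < #|porbit s j|)%N by have := ltn_ord t; lia.
have := @expg_porbit_inj _ s j t.+1 0 ht (ltn_trans (ltn0Sn _) ht).
by rewrite e expg0 perm1 => /(_ erefl).
Qed.

Lemma cycmin_eq s x y : cycmin s x -> cycmin s y -> y \in porbit s x -> x = y.
Proof.
move=> /forall_inP hx /forall_inP hy yx; apply/val_inj/eqP.
by rewrite eqn_leq hx // hy // porbit_sym.
Qed.

Lemma cycmin_flip s x y : cycmin (flip_cycle s x) y = cycmin s y.
Proof. by rewrite /cycmin porbit_flip_cycle. Qed.

Lemma exists_cycmin s x : exists2 y, porbit s y = porbit s x & cycmin s y.
Proof.
case: (@arg_minnP _ x (mem (porbit s x)) val (porbit_id s x)) => y yx ymin.
have e : porbit s y = porbit s x by apply/eqP; rewrite eq_porbit_mem.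
by exists y => //; apply/forall_inP => z; rewrite e; apply: ymin.
Qed.

(** Each cycle contains exactly one minimum, so the product over minima is a product over cycles. *)
Lemma prod_cycmin C s j :
  \prod_(x | (x \notin porbit s j) && cycmin s x) qre (cycprod C s x) =
  cycrest C setT j s.
Proof.
pose A := [set x | (x \notin porbit s j) && cycmin s x].
have inj : {in A &, injective (porbit s)}.
  move=> x y; rewrite !inE => /andP[_ hx] /andP[_ hy] e.
  by apply: (cycmin_eq hx hy); rewrite e porbit_id.
transitivity (\prod_(x in A) cycre C s (porbit s x)).
  by apply: eq_big => [x|x _]; rewrite ?inE ?cycreE.
rewrite -(big_imset _ inj) /cycrest; apply: eq_bigl => o.
rewrite subsetT /=; apply/imsetP/andP => [[x]|[/imsetP[x _ ->] hj]].
  by rewrite inE => /andP[hx _] ->; rewrite imset_f // porbit_sym.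
have [y e hy] := exists_cycmin s x; exists y; rewrite // inE hy andbT.
by rewrite porbit_sym e.
Qed.

(** Induction on [r]: inverting the cycle at the head [x] reduces its product to a real number,
    which [F'] absorbs. The later factors belong to other cycles, since [r] has no repetition and a
    cycle has only one minimum. *)
Lemma sum_cycles_re C (j : 'I_n) (r : seq 'I_n) (F G : 'S_n -> H) :
  qhermitian C -> uniq r ->
  (forall s x, F (flip_cycle s x) = F s) ->
  (forall s x, x \notin porbit s j -> G (flip_cycle s x) = G s) ->
  \sum_s F s * (\prod_(x <- r | (x \notin porbit s j) && cycmin s x)
                  cycprod C s x) * G s =
  \sum_s F s * (\prod_(x <- r | (x \notin porbit s j) && cycmin s x)
                  qreal (qre (cycprod C s x))) * G s.
Proof.
move=> hC; elim: r F => [|x r IH] F.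
  by move=> _ _ _; apply: eq_bigr => s _; rewrite !big_nil.
move=> /= /andP[xr Ur] hF hG.
pose Q s y := (y \notin porbit s j) && cycmin s y.
have hQ s y z : Q (flip_cycle s z) y = Q s y.
  by rewrite /Q porbit_flip_cycle cycmin_flip.
pose F' s := if Q s x then F s * qreal (qre (cycprod C s x)) else F s.
have hre s y z : qre (cycprod C (flip_cycle s z) y) = qre (cycprod C s y).
  by rewrite -!cycreE porbit_flip_cycle cycre_rev // imset_f.
transitivity (\sum_s F' s * (\prod_(y <- r | Q s y) cycprod C s y) * G s);
  last first.
  rewrite (IH F') //; first last.
    by move=> s y; rewrite /F' hQ hF hre.
  apply: eq_bigr => s _; rewrite big_cons /F' /Q.
  by case: ifP => _; rewrite -?mulrA.
rewrite (bigID (Q^~ x)) [RHS](bigID (Q^~ x)) /=; congr (_ + _); last first.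
  by apply: eq_bigr => s nQ; rewrite big_cons /F' -/(Q s x) (negbTE nQ).
transitivity (\sum_(s | Q s x) F s * cycprod C s x *
    ((\prod_(y <- r | Q s y) cycprod C s y) * G s)).
  by apply: eq_bigr => s Qx; rewrite big_cons -/(Q s x) Qx !mulrA.
rewrite (sum_cycprod_re hC) //; last first.
  move=> s Qx; rewrite hG; last by case/andP: Qx.
  congr (_ * _); rewrite big_seq_cond [RHS]big_seq_cond; apply: eq_big => [y|y].
    by rewrite hQ.
  case/andP=> yr; rewrite hQ => Qy; apply/eq_cycprod/flip_cycle_out.
  case/andP: Qx => _ hx; case/andP: Qy => _ hy; apply/negP => /(cycmin_eq hx hy) e.
  by rewrite e yr in xr.
by apply: eq_bigr => s Qx; rewrite /F' Qx !mulrA.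
Qed.

(** Only the cycle of [j] meets column [j], and only in its closing factor. All other cycles reduce
    to real parts, so their prescribed order no longer matters. *)
Lemma cdet_colrep C j b : qhermitian C ->
  cdet (colrep C j b) j = \sum_x minor_coef C setT j x * b x 0.
Proof.
move=> hC; rewrite minor_coef_sum.
pose F s : H := qreal ((-1) ^+ s).
pose G s : H := cycpath C s j * b (s^-1%g j) 0.
transitivity (\sum_s F s * (\prod_(x <- rev (enum 'I_n) |
    (x \notin porbit s j) && cycmin s x) cycprod C s x) * G s).
  apply: eq_bigr => s _; rewrite -mulrA sign_porbits /F rmorph_sign.
  rewrite cycprod_colrep; congr (_ * (_ * _)); apply: eq_bigr => x /andP[hx _].
  exact: cycprod_colrep_out.
rewrite sum_cycles_re ?rev_uniq ?enum_uniq //; first last.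
- move=> s x hx; rewrite /G; have hj : j \notin porbit s x by rewrite porbit_sym.
  rewrite (eq_cycpath _ (flip_cycle_out hj)); congr (_ * b _ _).
  apply: (canLR (permK _)); rewrite -(flip_cycle_out hj) ?permKV //.
  by rewrite -mem_porbit_perm permKV porbit_id.
- by move=> s x; rewrite /F odd_flip_cycle.
apply: eq_big => [s|s _]; first by rewrite perm_onT.
rewrite /F /G -rmorph_prod -rmorphM mulrA; congr (qreal (_ * _) * _ * _).
rewrite -prod_cycmin.
transitivity (\prod_(x <- enum 'I_n | (x \notin porbit s j) && cycmin s x)
    qre (cycprod C s x)).
  by apply: perm_big; rewrite perm_rev.
by rewrite big_enum_cond.
Qed.

Lemma colrep_col C j : colrep C j (col j C) = C.
Proof. by apply/matrixP => x y; rewrite !mxE; case: eqP => [->|]. Qed.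

Lemma cdet_hermitian C j : qhermitian C -> cdet C j = qreal (minor C setT).
Proof.
move=> hC; rewrite -{1}(colrep_col C j) cdet_colrep // -(minor_expand hC (in_setT j)).
by apply: eq_bigr => x _; rewrite mxE.
Qed.

Lemma cycmin_inv s x : cycmin s^-1 x = cycmin s x.
Proof. by rewrite /cycmin porbitV. Qed.

Lemma qconj_prod_seq (r : seq 'I_n) (P : pred 'I_n) (F : 'I_n -> H) :
  qconj (\prod_(x <- r | P x) F x) = \prod_(x <- rev r | P x) qconj (F x).
Proof.
elim: r => [|x r IH]; first by rewrite !big_nil -(rmorph1 (@qreal R)) qconj_real.
rewrite rev_cons -cats1 big_cat !big_cons big_nil /=; case: ifP => _; last by rewrite IH mulr1.
by rewrite qconjM IH mulr1.
Qed.

(** Conjugation reverses products: inverting the permutation restores the order inside each cycle,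
    and the increasing order of the cycles in [rdet] becomes the decreasing order in [cdet]. *)
Lemma cdet_adj C i : cdet (qadj C) i = qconj (rdet C i).
Proof.
rewrite /cdet /rdet raddf_sum (reindex_inj invg_inj) /=; apply: eq_bigr => s _.
rewrite porbitsV !qconjM cycprodV.
have -> (N : nat) : qconj ((-1) ^+ N : H) = (-1) ^+ N.
  by rewrite -signr_odd -(rmorph_sign (@qreal R)) qconj_real.
rewrite [RHS](commr_sign _ _).
congr (_ * (_ * _)).
transitivity (qconj (\prod_(x <- enum 'I_n | (x \notin porbit s i) && cycmin s x)
    cycprod C s x)); last by rewrite enumT [index_enum _]unlock.
rewrite qconj_prod_seq.
by apply: eq_big => [x|x _]; rewrite ?porbitV ?cycmin_inv ?cycprodV.
Qed.

Lemma qadjK m' n' : cancel (@qadj R m' n') (@qadj R n' m').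
Proof. by move=> A; apply/matrixP => i j; rewrite !mxE qconjK. Qed.

Lemma rdet_rowrep C i b : qhermitian C ->
  rdet (rowrep C i b) i = \sum_x b 0 x * qconj (minor_coef C setT i x).
Proof.
move=> hC; apply: (inv_inj (@qconjK R)); rewrite -cdet_adj.
have -> : qadj (rowrep C i b) = colrep C i (qadj b).
  by apply/matrixP => x y; rewrite -{2}hC !mxE; case: eqP.
rewrite cdet_colrep // raddf_sum /=; apply: eq_bigr => x _.
by rewrite qconjM qconjK mxE.
Qed.

Lemma hdet_minor C : qhermitian C -> hdet C = minor C setT.
Proof.
move=> hC; rewrite /hdet; case: pickP => [i _|no].
  by rewrite -qre_conj -cdet_adj hC cdet_hermitian // qre_real.
(* In order zero the only permutation has no cycles, so [minor] is 1, the default value of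
   [hdet]. *)
rewrite /minor (big_pred1 1%g) => [|s]; last first.
  by rewrite perm_onT inE; apply/esym/eqP/permP => x; have := no x.
rewrite odd_perm1 mul1r big_pred0 // => o.
by apply/negP => /andP[/imsetP[x _ _] _]; have := no x.
Qed.

End ColumnDeterminant.

(** * Sums of principal minors *)

Section Extension.
Variables (n : nat) (S : {set 'I_n}).
Implicit Types (s : 'S_#|S|) (a b : 'I_#|S|).
Local Notation ev := (@enum_val _ (mem S)).

(** Principal submatrices are indexed by ['I_#|S|]. Extending their permutations by the identity
    outside [S] lets minors of all orders be compared inside one symmetric group. *)
Definition ext_fun s x : 'I_n :=
  if [pick a | ev a == x] is Some a then ev (s a) else x.

Lemma ext_fun_in s a : ext_fun s (ev a) = ev (s a).
Proof.
rewrite /ext_fun; case: pickP => [b /eqP/enum_val_inj -> //|/(_ a)].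
by rewrite eqxx.
Qed.

Lemma ext_fun_out s x : x \notin S -> ext_fun s x = x.
Proof.
move=> hx; rewrite /ext_fun; case: pickP => // a /eqP e.
by move: hx; rewrite -e (enum_valP a).
Qed.

Lemma enum_val_onto x : x \in S -> exists a, x = ev a.
Proof. by move=> hx; exists (enum_rank_in hx x); rewrite enum_rankK_in. Qed.

Lemma ext_fun_inj s : injective (ext_fun s).
Proof.
move=> x y.
have [/enum_val_onto[a ->]|hx] := boolP (x \in S);
have [/enum_val_onto[b ->]|hy] := boolP (y \in S).
- by rewrite !ext_fun_in => /enum_val_inj/perm_inj ->.
- by rewrite ext_fun_in ext_fun_out // => e; move: hy; rewrite -e (enum_valP (s a)).
- by rewrite ext_fun_in ext_fun_out // => e; move: hx; rewrite e (enum_valP (s b)).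
- by rewrite !ext_fun_out.
Qed.

Definition ext_perm s : 'S_n := perm (@ext_fun_inj s).

Lemma ext_perm_in s a : ext_perm s (ev a) = ev (s a).
Proof. by rewrite permE ext_fun_in. Qed.

Lemma ext_perm_out s x : x \notin S -> ext_perm s x = x.
Proof. by rewrite permE; apply: ext_fun_out. Qed.

Lemma ext_perm_on s : perm_on S (ext_perm s).
Proof.
by apply/subsetP => x; rewrite inE; apply: contraR => /ext_perm_out ->.
Qed.

Lemma ext_perm_inj : injective ext_perm.
Proof.
move=> s s' e; apply/permP => a; apply: enum_val_inj.
by rewrite -!ext_perm_in e.
Qed.

(** Extension is injective, and both sides have as many elements as there are permutations of
    [S]. *)
Lemma ext_perm_image : [set s : 'S_n | perm_on S s] = ext_perm @: setT.
Proof.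
apply/esym/eqP; rewrite eqEcard; apply/andP; split.
  by apply/subsetP => _ /imsetP[s _ ->]; rewrite inE ext_perm_on.
by rewrite card_imset ?cardsT ?card_Sn ?cardsE ?card_perm //; apply: ext_perm_inj.
Qed.

Lemma ext_permM s s' : ext_perm (s * s')%g = (ext_perm s * ext_perm s')%g.
Proof.
apply/permP => x; rewrite permM.
have [/enum_val_onto[a ->]|hx] := boolP (x \in S).
  by rewrite !ext_perm_in permM.
by rewrite !ext_perm_out.
Qed.

Lemma ext_perm1 : ext_perm 1 = 1%g.
Proof.
apply/permP => x; rewrite perm1.
have [/enum_val_onto[a ->]|hx] := boolP (x \in S).
  by rewrite !ext_perm_in perm1.
by rewrite !ext_perm_out.
Qed.

Lemma ext_tperm a b : ext_perm (tperm a b) = tperm (ev a) (ev b).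
Proof.
apply/permP => x; have [/enum_val_onto[c ->]|hx] := boolP (x \in S).
  by rewrite ext_perm_in inj_tperm //; apply: enum_val_inj.
by rewrite ext_perm_out // tpermD //; apply: contraNneq hx => <-; apply: enum_valP.
Qed.

(** A product of transpositions extends factor by factor to a product of transpositions. *)
Lemma odd_ext_perm s : odd_perm (ext_perm s) = odd_perm s.
Proof.
have [ts -> _] := prod_tpermP s; elim: ts => [|[a b] ts IH] /=.
  by rewrite !big_nil ext_perm1 !odd_perm1.
rewrite !big_cons ext_permM !odd_permM IH ext_tperm !odd_tperm.
by rewrite (inj_eq enum_val_inj).
Qed.

Lemma ext_permX s t a : (ext_perm s ^+ t)%g (ev a) = ev ((s ^+ t)%g a).
Proof.
elim: t => [|t IH]; first by rewrite !expg0 !perm1.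
by rewrite !permXSr IH ext_perm_in.
Qed.

Lemma porbit_ext s a : porbit (ext_perm s) (ev a) = ev @: porbit s a.
Proof.
apply/setP => x; apply/porbitP/imsetP => [[t ->]|[_ /porbitP[t ->] ->]].
  by exists ((s ^+ t)%g a); rewrite ?mem_porbit // ext_permX.
by exists t; rewrite ext_permX.
Qed.

Lemma porbits_ext s :
  [set o in porbits (ext_perm s) | o \subset S] =
  (fun o : {set 'I_#|S|} => ev @: o) @: porbits s.
Proof.
apply/setP => o; rewrite inE; apply/andP/imsetP => [[/imsetP[x _ ->] oS]|].
  have /enum_val_onto[a xa] : x \in S by apply: (subsetP oS); apply: porbit_id.
  by exists (porbit s a); rewrite ?imset_f // xa porbit_ext.
move=> [_ /imsetP[a _ ->] ->]; rewrite -porbit_ext imset_f //; split=> //.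
exact: porbit_subset (ext_perm_on s) (enum_valP a).
Qed.

Variable R : rcfType.
Variable C : 'M[quat R]_n.

Lemma cycprod_ext s a : cycprod C (ext_perm s) (ev a) = cycprod (subsq C S) s a.
Proof.
rewrite /cycprod porbit_ext card_imset; last exact: enum_val_inj.
by apply: eq_bigr => t _; rewrite mxE !ext_permX.
Qed.

Lemma cycpath_ext s a : cycpath C (ext_perm s) (ev a) = cycpath (subsq C S) s a.
Proof.
rewrite /cycpath porbit_ext card_imset; last exact: enum_val_inj.
by apply: eq_bigr => t _; rewrite mxE !ext_permX.
Qed.

Lemma prod_cycre_ext (P : pred {set 'I_n}) s :
  \prod_(o in porbits (ext_perm s) | (o \subset S) && P o) cycre C (ext_perm s) o =
  \prod_(o in porbits s | P (ev @: o)) cycre (subsq C S) s o.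
Proof.
transitivity (\prod_(o in [set o in porbits (ext_perm s) | o \subset S] | P o)
    cycre C (ext_perm s) o).
  by apply: eq_bigl => o; rewrite inE andbA.
rewrite porbits_ext big_imset_cond /=; last first.
  by move=> o o' _ _; apply: imset_inj; apply: enum_val_inj.
apply: eq_bigr => _ /andP[/imsetP[a _ ->] _].
by rewrite -porbit_ext !cycreE cycprod_ext.
Qed.

Lemma minor_coef_sub a b :
  minor_coef (subsq C S) setT a b = minor_coef C S (ev a) (ev b).
Proof.
rewrite /minor_coef; apply/esym.
rewrite (eq_bigl (fun s : 'S_n => (s \in [set s : 'S_n | perm_on S s]) && (s (ev b) == ev a)));
  last by move=> s; rewrite inE.
rewrite ext_perm_image big_imset_cond; last by move=> s s' _ _; apply: ext_perm_inj.
apply: eq_big => [s|s _].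
  by rewrite inE ext_perm_in (inj_eq enum_val_inj) perm_onT.
rewrite odd_ext_perm cycpath_ext; congr (qreal (_ * _) * _).
rewrite /cycrest prod_cycre_ext; apply: eq_bigl => o.
by rewrite subsetT mem_imset //; apply: enum_val_inj.
Qed.

Lemma minor_sub : minor (subsq C S) setT = minor C S.
Proof.
rewrite /minor; apply/esym.
rewrite (eq_bigl (fun s : 'S_n => s \in [set s : 'S_n | perm_on S s]));
  last by move=> s; rewrite inE.
rewrite ext_perm_image big_imset; last by move=> s s' _ _; apply: ext_perm_inj.
apply: eq_big => [s|s _]; first by rewrite inE perm_onT.
rewrite odd_ext_perm; congr (_ * _).
have := prod_cycre_ext predT s.
rewrite (eq_bigl (fun o => (o \in porbits (ext_perm s)) && (o \subset S))); last first.
  by move=> o; rewrite andbT.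
by move=> ->; apply: eq_bigl => o; rewrite subsetT.
Qed.

End Extension.

(** * Matrices of summed minor coefficients and their recursion *)

Section MinorSums.
Variables (R : rcfType) (n : nat).
Local Notation H := (quat R).
Variable C : 'M[H]_n.
Hypothesis hC : qhermitian C.

Definition minor_mx r : 'M[H]_n :=
  \matrix_(k, l) \sum_(S : {set 'I_n} | (#|S| == r) && (k \in S)) minor_coef C S k l.

Lemma subsq_hermitian (S : {set 'I_n}) : qhermitian (subsq C S).
Proof. by apply/matrixP => a b; rewrite !mxE -[in RHS]hC mxE. Qed.

Lemma dsumE r : dsum r C = \sum_(S : {set 'I_n} | #|S| == r) minor C S.
Proof.
by apply: eq_bigr => S _; rewrite hdet_minor ?minor_sub //; apply: subsq_hermitian.
Qed.

Lemma subsq_colrep (S : {set 'I_n}) a b :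
  subsq (colrep C (enum_val a) b) S =
  colrep (subsq C S) a (\col_i b (enum_val i) 0).
Proof.
by apply/matrixP => i j; rewrite !mxE (inj_eq enum_val_inj).
Qed.

(** This and [rdsumE] turn the determinantal numerators into matrix products, so that the formulas
    become matrix identities. *)
Lemma cdsumE r k b : cdsum r C k b = (minor_mx r *m b) k 0.
Proof.
rewrite /cdsum mxE; under [RHS]eq_bigr do rewrite mxE mulr_suml.
rewrite exchange_big /=; apply: eq_bigr => S /andP[_ kS].
have [a ka] := enum_val_onto kS; rewrite (big_pred1 a) => [|a']; last first.
  by rewrite ka (inj_eq enum_val_inj).
rewrite {1}ka subsq_colrep cdet_colrep; last exact: subsq_hermitian.
rewrite (bigID (mem S)) /= [X in _ = _ + X]big1 ?addr0 => [|x hx]; last first.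
  by rewrite minor_coef_out ?mul0r.
rewrite [RHS]big_enum_val /=; apply: eq_bigr => x _.
by rewrite minor_coef_sub mxE -ka.
Qed.

Lemma subsq_rowrep (S : {set 'I_n}) a b :
  subsq (rowrep C (enum_val a) b) S =
  rowrep (subsq C S) a (\row_i b 0 (enum_val i)).
Proof.
by apply/matrixP => i j; rewrite !mxE (inj_eq enum_val_inj).
Qed.

Lemma rdsumE r l b : rdsum r C l b = (b *m qadj (minor_mx r)) 0 l.
Proof.
rewrite /rdsum mxE; under [RHS]eq_bigr do rewrite !mxE raddf_sum mulr_sumr.
rewrite exchange_big /=; apply: eq_bigr => S /andP[_ lS].
have [a la] := enum_val_onto lS; rewrite (big_pred1 a) => [|a']; last first.
  by rewrite la (inj_eq enum_val_inj).
rewrite {1}la subsq_rowrep rdet_rowrep; last exact: subsq_hermitian.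
rewrite (bigID (mem S)) /= [X in _ = _ + X]big1 ?addr0 => [|x hx]; last first.
  by rewrite minor_coef_out ?raddf0 ?mulr0.
rewrite [RHS]big_enum_val /=; apply: eq_bigr => x _.
by rewrite minor_coef_sub mxE -la.
Qed.

Lemma card_eq_setT (S : {set 'I_n}) : (#|S| == n) = (S == setT).
Proof.
apply/eqP/eqP => [e|->]; last by rewrite cardsT card_ord.
by apply/eqP; rewrite eqEcard subsetT cardsT card_ord e leqnn.
Qed.

Lemma minor_mx_full : minor_mx n = \matrix_(k, l) minor_coef C setT k l.
Proof.
apply/matrixP => k l; rewrite !mxE (big_pred1 setT) // => S.
by rewrite card_eq_setT; apply/andP/eqP => [[/eqP]|->]; rewrite // inE.
Qed.

Lemma cdetE k b : cdet (colrep C k b) k = (minor_mx n *m b) k 0.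
Proof.
by rewrite cdet_colrep // minor_mx_full mxE; apply: eq_bigr => x _; rewrite mxE.
Qed.

Lemma rdetE l b : rdet (rowrep C l b) l = (b *m qadj (minor_mx n)) 0 l.
Proof.
by rewrite rdet_rowrep // minor_mx_full mxE; apply: eq_bigr => x _; rewrite !mxE.
Qed.

Lemma hdetE : hdet C = dsum n C.
Proof.
rewrite hdet_minor // dsumE (big_pred1 setT) // => S; exact: card_eq_setT.
Qed.

Lemma minor_mx0 : minor_mx 0 = 0.
Proof.
apply/matrixP => k l; rewrite !mxE big_pred0 // => S.
by rewrite cards_eq0; apply/negP => /andP[/eqP ->]; rewrite inE.
Qed.

Lemma minor_mx_big r : (n < r)%N -> minor_mx r = 0.
Proof.
move=> nr; apply/matrixP => k l; rewrite !mxE big_pred0 // => S.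
apply/negP => /andP[/eqP e _]; move: nr; rewrite -e ltnNge -[X in (_ <= X)%N]card_ord.
by rewrite max_card.
Qed.

(** The empty minor is 1, which guarantees that some index has a nonzero minor sum. *)
Lemma dsum0 : dsum 0 C = 1.
Proof.
rewrite dsumE (big_pred1 set0) => [|S]; last by rewrite cards_eq0.
rewrite /minor (big_pred1 1%g) => [|s]; last first.
  apply/idP/eqP => [h|->]; last exact: perm_on1.
  by apply/permP => x; rewrite (out_perm h) ?inE // perm1.
rewrite odd_perm1 mul1r big_pred0 // => o; rewrite subset0.
by apply/negP => /andP[/imsetP[x _ ->] /eqP/setP/(_ x)]; rewrite porbit_id inE.
Qed.

(* Newton-type recursion: it makes every [minor_mx r] a real polynomial in [C]
   and, read at [r = n + 1], contains the Cayley-Hamilton theorem. *)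
Lemma minor_mxS r : minor_mx r *m C + minor_mx r.+1 = (qreal (dsum r C))%:M.
Proof.
have E k l : (minor_mx r *m C) k l =
    \sum_(S : {set 'I_n} | (#|S| == r) && (k \in S)) \sum_x minor_coef C S k x * C x l.
  by rewrite mxE; under eq_bigr do rewrite mxE mulr_suml; rewrite exchange_big.
(* Removing [l] matches the sets of size [r + 1] containing [l] with the sets of size [r] avoiding
   [l]. *)
have shift (k l : 'I_n) (Q : pred {set 'I_n}) (f : {set 'I_n} -> H) :
    (forall S, Q (S :\ l) = Q S) ->
    \sum_(S : {set 'I_n} | [&& #|S| == r.+1, Q S & l \in S]) f (S :\ l) =
    \sum_(S : {set 'I_n} | [&& #|S| == r, Q S & l \notin S]) f S.
  move=> hQ; rewrite [RHS](reindex_onto (fun S => S :\ l) (fun S => l |: S)) /=; last first.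
    by move=> S /and3P[_ _ lS]; rewrite setU1K.
  apply: eq_bigl => S; rewrite hQ !inE eqxx /= andbT.
  have [lS|lS] := boolP (l \in S).
    by rewrite setD1K // eqxx !andbT (cardsD1 l S) lS.
  rewrite !andbF; apply/esym/negP => /andP[_ /eqP e].
  by move: lS; rewrite -e !inE eqxx.
apply/matrixP => k l; rewrite mxE E !mxE.
have [->|kl] := eqVneq k l.
  (* On the diagonal, the minors of order [r] on sets containing the index come from the first
     summand, and those on sets avoiding it from the second. *)
  rewrite mulr1n dsumE rmorph_sum /= [RHS](bigID (fun S : {set 'I_n} => l \in S)) /=.
  congr (_ + _).
    by apply: eq_bigr => S /andP[_ lS]; apply: minor_expand.
  rewrite (eq_bigr (fun S => qreal (minor C (S :\ l)))); last first.
    by move=> S /andP[_ lS]; apply: minor_coef_diag.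
  exact: (shift l l predT (fun S => qreal (minor C S))).
(* Off the diagonal, the sets of size [r] containing [l] contribute zero, and those avoiding [l]
   cancel against the coefficients of order [r + 1]. *)
rewrite mulr0n; apply/eqP; rewrite addr_eq0; apply/eqP.
rewrite (bigID (fun S : {set 'I_n} => l \in S)) /= big1 ?add0r; last first.
  by move=> S /andP[/andP[_ kS] lS]; apply: minor_expand_alien.
rewrite [in RHS](bigID (fun S : {set 'I_n} => l \in S)) /=.
rewrite [X in - (_ + X)]big1 ?addr0; last first.
  by move=> S /andP[/andP[_ kS] lS]; apply: minor_coef_out.
rewrite [in RHS](eq_bigr (fun S => - \sum_x minor_coef C (S :\ l) k x * C x l)); last first.
  by move=> S /andP[/andP[_ kS] lS]; apply: minor_coef_offdiag.
rewrite sumrN opprK.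
have hQ (S : {set 'I_n}) : (k \in S :\ l) = (k \in S) by rewrite !inE kl.
transitivity (\sum_(S : {set 'I_n} | [&& #|S| == r, k \in S & l \notin S])
    \sum_x minor_coef C S k x * C x l).
  by apply: eq_bigl => S; rewrite andbA.
rewrite -(shift k l (fun S => k \in S) (fun S => \sum_x minor_coef C S k x * C x l) hQ).
by apply: eq_bigl => S; rewrite andbA.
Qed.

(** Each minor of order [r] is counted once for each of the [r] elements of its index set. *)
Lemma minor_mx_tr r : \sum_k qre ((minor_mx r *m C) k k) = r%:R * dsum r C.
Proof.
rewrite dsumE mulr_sumr.
transitivity (\sum_k \sum_(S : {set 'I_n} | (#|S| == r) && (k \in S)) minor C S).
  apply: eq_bigr => k _; rewrite mxE.
  under eq_bigr do rewrite mxE mulr_suml.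
  rewrite exchange_big raddf_sum /=; apply: eq_bigr => S /andP[_ kS].
  by rewrite minor_expand // qre_real.
rewrite (exchange_big_dep (fun S : {set 'I_n} => #|S| == r)) /=; last first.
  by move=> k S _ /andP[].
apply: eq_bigr => S /eqP Sr; rewrite -Sr (eq_bigl (mem S)) => [|k]; last first.
  by rewrite eqxx.
by rewrite sumr_const mulr_natl.
Qed.

End MinorSums.

(** * Rank and weighted Moore-Penrose inverses *)

Section QuaternionMatrices.
Variable R : rcfType.
Local Notation H := (quat R).

Lemma qadjM m n p (A : 'M[H]_(m, n)) (B : 'M[H]_(n, p)) :
  qadj (A *m B) = qadj B *m qadj A.
Proof.
apply/matrixP => i j; rewrite !mxE raddf_sum /=; apply: eq_bigr => k _.
by rewrite qconjM !mxE.
Qed.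

Lemma qadj_is_additive m n : zmod_morphism (@qadj R m n).
Proof. by move=> A B; apply/matrixP => i j; rewrite !mxE raddfB. Qed.
HB.instance Definition _ m n :=
  GRing.isZmodMorphism.Build 'M[H]_(m, n) 'M[H]_(n, m) (@qadj R m n)
    (@qadj_is_additive m n).

Lemma qadj1 n : qadj (1%:M : 'M[H]_n) = 1%:M.
Proof.
apply/matrixP => i j; rewrite !mxE eq_sym.
by case: (i == j); rewrite ?raddf0 // -(rmorph1 (@qreal R)) qconj_real.
Qed.

Lemma qadjZ m n a (A : 'M[H]_(m, n)) : qadj (qreal a *: A) = qreal a *: qadj A.
Proof. by apply/matrixP => i j; rewrite !mxE qconjM qconj_real qrealC. Qed.

Lemma mulmxZ m n p a (A : 'M[H]_(m, n)) (B : 'M[H]_(n, p)) :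
  A *m (qreal a *: B) = qreal a *: (A *m B).
Proof.
apply/matrixP => i j; rewrite !mxE mulr_sumr; apply: eq_bigr => k _.
by rewrite !mxE !mulrA qrealC.
Qed.

Lemma mulmx_real m n a (A : 'M[H]_(m, n)) : A *m (qreal a)%:M = qreal a *: A.
Proof. by rewrite -scalemx1 mulmxZ mulmx1. Qed.

Lemma qadj_inv n (C D : 'M[H]_n) : qhermitian C -> C *m D = 1%:M ->
  D *m C = 1%:M -> qhermitian D.
Proof.
move=> hC CD DC; have := congr1 (@qadj R n n) CD; rewrite qadjM hC qadj1 => h.
by rewrite /qhermitian -[LHS]mulmx1 -CD mulmxA h mul1mx.
Qed.

Lemma gram_hermitian m n (K : 'M[H]_(m, n)) : qhermitian (qadj K *m K).
Proof. by rewrite /qhermitian qadjM qadjK. Qed.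

Lemma gram_eq0 m n (X : 'M[H]_(m, n)) : qadj X *m X = 0 -> X = 0.
Proof.
move=> X0; apply/matrixP => i j; rewrite mxE.
have /matrixP/(_ j j) := X0; rewrite !mxE => /(congr1 (@qre R)).
rewrite raddf_sum raddf0 /= => /eqP; rewrite psumr_eq0 => [|k _]; last first.
  by rewrite mxE qreMC qmulconj_ge0.
by move=> /allP/(_ i (mem_index_enum _)); rewrite /= mxE qreMC => /eqP/qmulconj_eq0.
Qed.

Lemma gram_eq0r m n (X : 'M[H]_(m, n)) : X *m qadj X = 0 -> X = 0.
Proof.
rewrite -{1}(qadjK X) => /gram_eq0 e.
by rewrite -(qadjK X) e raddf0.
Qed.

(** The product of [X C] with its own adjoint is [X C C] times the adjoint of [X], hence zero, and
    the real part of [x * qconj x] vanishes only at zero. *)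
Lemma mulmx_hermitian_sqr m n (X : 'M[H]_(m, n)) C : qhermitian C ->
  X *m C *m C = 0 -> X *m C = 0.
Proof.
move=> hC XCC; apply: gram_eq0r.
by rewrite qadjM hC mulmxA XCC mul0mx.
Qed.

Lemma mulmx_gram_eq0 m n p (X : 'M[H]_(m, n)) (K : 'M[H]_(p, n)) :
  X *m (qadj K *m K) = 0 -> X *m qadj K = 0.
Proof.
move=> XKK; apply: gram_eq0r.
by rewrite qadjM qadjK mulmxA -(mulmxA X) XKK mul0mx.
Qed.

(** Over the quaternions the trace of a product depends on the order of the factors; its real part
    does not. *)
Definition retr n (A : 'M[H]_n) : R := qre (\tr A).

Lemma retrC m n (A : 'M[H]_(m, n)) (B : 'M[H]_(n, m)) :
  retr (A *m B) = retr (B *m A).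
Proof.
rewrite /retr /mxtrace !raddf_sum /=.
transitivity (\sum_i \sum_j qre (A i j * B j i)).
  by apply: eq_bigr => i _; rewrite mxE raddf_sum.
rewrite exchange_big; apply: eq_bigr => j _; rewrite mxE raddf_sum.
by apply: eq_bigr => i _; rewrite qreMC.
Qed.

Lemma retr_adj n (A : 'M[H]_n) : retr (qadj A) = retr A.
Proof.
rewrite /retr /mxtrace !raddf_sum /=.
by apply: eq_bigr => i _; rewrite mxE qre_conj.
Qed.

Lemma retrZ n a (A : 'M[H]_n) : retr (qreal a *: A) = a * retr A.
Proof.
rewrite /retr /mxtrace !raddf_sum /= mulr_sumr.
by apply: eq_bigr => i _; rewrite mxE qreM_real.
Qed.

(** By the recursion each [minor_mx] is a polynomial in [C] with real, hence central,
    coefficients. *)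
Lemma minor_mx_comm n (C : 'M[H]_n) r : qhermitian C ->
  minor_mx C r *m C = C *m minor_mx C r.
Proof.
move=> hC; elim: r => [|r IH]; first by rewrite minor_mx0 mul0mx mulmx0.
have e : minor_mx C r.+1 = (qreal (dsum r C))%:M - minor_mx C r *m C.
  by rewrite -(minor_mxS hC) addrC addKr.
rewrite e mulmxBl mulmxBr (mul_scalar_mx (qreal (dsum r C))) mulmx_real mulmxA.
rewrite IH; reflexivity.
Qed.

Lemma hermitian_minor_mx n (C : 'M[H]_n) : qhermitian C ->
  exists2 r, dsum r C != 0 &
    minor_mx C r *m C *m C = qreal (dsum r C) *: C.
Proof.
move=> hC; pose P r := (r <= n)%N && (dsum r C != 0).
have exP : exists r, P r by exists 0; rewrite /P dsum0 ?oner_eq0.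
have ubP r : P r -> (r <= n)%N by case/andP.
have [r /andP[rn Dr] rmax] := ex_maxnP exP ubP; exists r => //.
(* Downward induction from order [n + 1], where [minor_mx] is zero. Above the maximal [r] the
   recursion reads [minor_mx j *m C = - minor_mx (j + 1)]; a further factor [C] gives zero by
   induction, and is then cancelled. *)
have vanish t : (t <= n - r)%N -> minor_mx C (n.+1 - t)%N *m C = 0.
  elim: t => [|t IH] lt; first by rewrite subn0 minor_mx_big ?mul0mx.
  have nt : (n.+1 - t = (n.+1 - t.+1).+1)%N by lia.
  have D0 : dsum (n.+1 - t.+1) C = 0.
    apply/eqP/negPn/negP => D0; have : P (n.+1 - t.+1)%N by rewrite /P D0 andbT; lia.
    by move/rmax; lia.
  apply: mulmx_hermitian_sqr => //.
  have := minor_mxS hC (n.+1 - t.+1)%N; rewrite D0 raddf0 raddf0 -nt.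
  move=> /eqP; rewrite addr_eq0 => /eqP ->.
  by rewrite mulNmx IH ?oppr0 //; lia.
have v : minor_mx C r.+1 *m C = 0.
  by have := vanish (n - r)%N (leqnn _); rewrite (_ : n.+1 - (n - r) = r.+1)%N //; lia.
by rewrite -mul_scalar_mx -(minor_mxS hC) mulmxDl v addr0.
Qed.

Lemma gram_minor_mx m n (K : 'M[H]_(m, n)) : let G := qadj K *m K in
  exists r, [/\ dsum r G != 0,
    minor_mx G r *m G *m qadj K = qreal (dsum r G) *: qadj K &
    exists2 Z, K *m Z *m K = K & retr (K *m Z) = r%:R].
Proof.
move=> G; have hG : qhermitian G := gram_hermitian K.
have [r D0 e] := hermitian_minor_mx hG; exists r.
have e' : minor_mx G r *m G *m qadj K = qreal (dsum r G) *: qadj K.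
  apply/eqP; rewrite -subr_eq0 -mul_scalar_mx -mulmxBl; apply/eqP/mulmx_gram_eq0.
  by rewrite mulmxBl e mul_scalar_mx subrr.
(* The adjoint of [e'], after commuting [minor_mx G r] with [G], is exactly [K Z K = K] for this
   [Z]. The real trace of [K Z] is computed by [minor_mx_tr]. *)
split=> //; exists (qreal (dsum r G)^-1 *: (qadj (minor_mx G r) *m qadj K)).
  rewrite mulmxZ -scalemxAl -(mulmxA K) -(mulmxA _ (qadj K)) -/G.
  have := congr1 (@qadj R _ _) e'; rewrite minor_mx_comm // 2!qadjM hG qadjZ !qadjK.
  by move=> ->; rewrite scalerA -rmorphM mulVf // rmorph1 scale1r.
rewrite mulmxZ retrZ retrC -mulmxA -/G.
rewrite -[X in _ *m X]hG -qadjM retr_adj retrC.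
rewrite /retr /mxtrace raddf_sum /= minor_mx_tr //.
by rewrite mulrCA mulVf ?mulr1.
Qed.

Lemma inner_inverse m n (K : 'M[H]_(m, n)) : exists Z, K *m Z *m K = K.
Proof. by have [r [_ _ [Z e _]]] := gram_minor_mx K; exists Z. Qed.

(** For an inner inverse [Z] the matrix [K] kills every column of [Z K - I], so injectivity makes
    [Z] a left inverse. *)
Lemma left_inverse_ex m n (K : 'M[H]_(m, n)) :
  (forall w : 'cV_n, K *m w = 0 -> w = 0) -> exists L, L *m K = 1%:M.
Proof.
move=> inj; have [Z e] := inner_inverse K; exists Z.
apply/eqP; rewrite -subr_eq0; apply/eqP.
have K0 : K *m (Z *m K - 1%:M) = 0 by rewrite mulmxBr mulmx1 mulmxA e subrr.
apply/matrixP => i j; have := inj (col j (Z *m K - 1%:M)).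
rewrite {1}colE mulmxA K0 mul0mx => /(_ erefl)/colP/(_ i).
by rewrite !mxE.
Qed.

Lemma posdef_inverse n (C : 'M[H]_n) : qposdef C ->
  exists2 D, D *m C = 1%:M & C *m D = 1%:M.
Proof.
case=> hC pC; have [|L LC] := @left_inverse_ex n n C.
  move=> w Cw; apply/eqP/negPn/negP => w0; have [_] := pC w w0.
  by rewrite -mulmxA Cw mulmx0 !mxE ltxx.
exists L => //; have := congr1 (@qadj R n n) LC; rewrite qadjM hC qadj1 => CL.
by rewrite -[X in X = _]mulmx1 -CL mulmxA -(mulmxA C) LC mulmx1.
Qed.

(* The real trace of the idempotent [A *m Z] is a notion of rank which is
   manifestly invariant under adjunction and invertible factors. *)
Definition trace_rank m n (A : 'M[H]_(m, n)) (r : nat) : Prop :=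
  forall Z, A *m Z *m A = A -> retr (A *m Z) = r%:R.

(** The index found in [gram_minor_mx] is the real trace of some [K Z] with [Z] an inner inverse, so
    it must be [r]. *)
Lemma trace_rank_gram m n (K : 'M[H]_(m, n)) r : trace_rank K r ->
  let G := qadj K *m K in dsum r G != 0 /\
    minor_mx G r *m G *m qadj K = qreal (dsum r G) *: qadj K.
Proof.
move=> Kr G; have [s [D0 e [Z KZK tZ]]] := gram_minor_mx K.
have /eqP := Kr Z KZK; rewrite tZ eqr_nat => /eqP sr.
by rewrite -sr.
Qed.

Lemma trace_rank_adj m n (A : 'M[H]_(m, n)) r :
  trace_rank A r -> trace_rank (qadj A) r.
Proof.
move=> Ar Z AZA; rewrite -retr_adj qadjM qadjK retrC.
by apply: Ar; have := congr1 (@qadj R _ _) AZA; rewrite !qadjM qadjK mulmxA.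
Qed.

(** If [Z] is an inner inverse of [U A V], then [V Z U] is one of [A], and rotating the factors
    keeps the real trace. *)
Lemma trace_rank_mul m n (A : 'M[H]_(m, n)) (U L : 'M[H]_m) (V W : 'M[H]_n) r :
  L *m U = 1%:M -> V *m W = 1%:M -> trace_rank A r -> trace_rank (U *m A *m V) r.
Proof.
move=> LU VW Ar Z e.
rewrite -!mulmxA retrC !mulmxA -(mulmxA A) -(mulmxA A); apply: Ar.
have := congr1 (fun X => L *m X *m W) e.
by rewrite !mulmxA LU mul1mx -!mulmxA VW !mulmx1.
Qed.

(** A maximal independent set of columns [AS] has a left inverse [L], and [A = AS (L A)]. Cancelling
    in [A Z A = A] gives [L A Z AS = I] of order [r], whose real trace is that of [A Z]. *)
Lemma qrank_trace_rank m n (A : 'M[H]_(m, n)) r : qrank A r -> trace_rank A r.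
Proof.
move=> [[S [Sind Sr]] Smax] Z AZA.
pose f (a : 'I_#|S|) : 'I_n := enum_val a; pose AS := colsub f A.
have injAS (w : 'cV_#|S|) : AS *m w = 0 -> w = 0.
  move=> ASw; pose lam x : H := \sum_(a | f a == x) w a 0.
  have lamE a : lam (f a) = w a 0.
    by rewrite /lam (big_pred1 a) // => b; rewrite /= (inj_eq enum_val_inj).
  apply/colP => a; rewrite mxE -lamE; apply: (Sind lam) => [i|]; last exact: enum_valP.
  rewrite big_enum_val /=; have /colP/(_ i) := ASw; rewrite !mxE => h; rewrite -[RHS]h.
  by apply: eq_bigr => b _; rewrite lamE mxE.
have [L LAS] := left_inverse_ex injAS.
have AE : A = AS *m (L *m A).
  (* [E] is [A] minus its projection [AS L A], so it vanishes on the columns in [S]. A nonzero entry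
     of [E] in column [j] would make [j |: S] independent, against maximality. *)
  apply/eqP; rewrite -subr_eq0; set E := A - _; apply/eqP/matrixP => i j.
  rewrite [RHS]mxE; apply/eqP/negPn/negP => Eij.
  have EE : E = (1%:M - AS *m L) *m A by rewrite /E mulmxBl mul1mx mulmxA.
  have ES x : x \in S -> col x E = 0.
    move=> /enum_val_onto[a ->]; rewrite EE colE -mulmxA -colE -(col_colsub f) -/AS.
    by rewrite colE mulmxA mulmxBl mul1mx -(mulmxA AS) LAS mulmx1 subrr mul0mx.
  have jS : j \notin S.
    by apply: contra Eij => /ES/colP/(_ i); rewrite !mxE => ->.
  have : rindep A (j |: S).
    move=> lam h.
    have h' i' : E i' j * lam j = 0.
      transitivity (\sum_(x in j |: S) E i' x * lam x).
        rewrite big_setU1 //= [X in _ + X]big1 ?addr0 // => x xS.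
        by have /colP/(_ i') := ES x xS; rewrite !mxE => ->; rewrite mul0r.
      rewrite EE; under eq_bigr do rewrite mxE mulr_suml.
      rewrite exchange_big big1 //= => y _.
      by under eq_bigr do rewrite -mulrA; rewrite -mulr_sumr h mulr0.
    have lj : lam j = 0 by apply: qmulf_eq0 (h' i) Eij.
    move=> x /setU1P[->|xS] //; apply: Sind xS => i'.
    by have := h i'; rewrite big_setU1 //= lj mulr0 add0r.
  by move/Smax; rewrite cardsU1 jS Sr; lia.
have F1 : colsub f (L *m A) = 1%:M by rewrite -mulmx_colsub.
have h : L *m A *m Z *m AS *m (L *m A) = L *m A.
  by rewrite -[LHS]mulmxA -AE -!mulmxA (mulmxA A) AZA.
have h' : L *m A *m Z *m AS = 1%:M.
  by have := congr1 (colsub f) h; rewrite -mulmx_colsub F1 mulmx1.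
rewrite AE -mulmxA retrC h' /retr mxtrace1 -[X in _ = X%:R]Sr.
by rewrite -(rmorph_nat (@qreal R)) qre_real.
Qed.

(** To be read with [S] the adjoint of [A]: multiplying by [X] and the Gram matrix acts as the
    scalar [d] on [Nhi *m S], hence on [Nh *m Y], which factors through it by [T]. *)
Lemma cramer_assemble m n (A : 'M[H]_(m, n)) (S : 'M[H]_(n, m)) (M : 'M[H]_m)
    (Nh Nhi X : 'M[H]_n) (Y : 'M[H]_(n, m)) (T : 'M[H]_m) d :
  S *m M = S *m M *m A *m Y -> Nhi *m Nh = 1%:M -> Nh *m Y = Nhi *m S *m T ->
  X *m (Nhi *m S *m M *m A *m Nhi) *m (Nhi *m S) = qreal d *: (Nhi *m S) ->
  Nhi *m X *m Nhi *m (S *m M) = qreal d *: Y.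
Proof.
move=> SM NiN NY XG.
have e : X *m (Nhi *m S *m M *m A *m Nhi) *m (Nh *m Y) = X *m Nhi *m (S *m M).
  by rewrite SM -!mulmxA (mulmxA Nhi Nh Y) NiN mul1mx.
have e' : X *m (Nhi *m S *m M *m A *m Nhi) *m (Nh *m Y) = qreal d *: (Nh *m Y).
  by rewrite NY mulmxA XG -scalemxAl.
by rewrite -mulmxA -mulmxA (mulmxA X) -e e' mulmxZ mulmxA NiN mul1mx.
Qed.

Lemma wmp_cramer m n (A : 'M[H]_(m, n)) (M Mh Ml : 'M[H]_m) (N Nh Nhi : 'M[H]_n)
    (Y : 'M[H]_(n, m)) r :
  trace_rank A r -> qhermitian Mh -> Ml *m Mh = 1%:M -> Mh *m Ml = 1%:M ->
  Mh *m Mh = M -> qhermitian Nh -> Nh *m Nh = N ->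
  Nh *m Nhi = 1%:M -> Nhi *m Nh = 1%:M -> wmp M N A Y ->
  let K := Mh *m A *m Nhi in let G := qadj K *m K in
  dsum r G != 0 /\
  Nhi *m minor_mx G r *m Nhi *m qadj A *m M = qreal (dsum r G) *: Y.
Proof.
move=> Ar hMh MlM MMl hM hNh hN NNi NiN [AYA YAY hMAY hNYA] K G.
have hNhi : qhermitian Nhi := qadj_inv hNh NNi NiN.
have [D0 e] : dsum r G != 0 /\ minor_mx G r *m G *m qadj K = qreal (dsum r G) *: qadj K.
  by apply: trace_rank_gram; apply: (trace_rank_mul MlM NiN).
split=> //.
have hMM : qadj M = M by rewrite -hM qadjM hMh.
have hNN : qadj N = N by rewrite -hN qadjM hNh.
have KE : qadj K = Nhi *m qadj A *m Mh by rewrite !qadjM hMh hNhi mulmxA.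
have GE : G = Nhi *m qadj A *m M *m A *m Nhi.
  by rewrite /G KE -hM !mulmxA.
(* The normal equation, from [A Y A = A] and the Hermitian [M A Y]. *)
have AM : qadj A *m M = qadj A *m M *m A *m Y.
  rewrite -{1}hMM -qadjM -{1}AYA !mulmxA qadjM hMAY.
  by rewrite !mulmxA.
(* From [Y A Y = Y] and the Hermitian [N Y A], after writing [Nh] as [Nhi *m N]. *)
have NY : Nh *m Y = Nhi *m qadj A *m (qadj Y *m N *m Y).
  have e1 : N *m Y *m A = qadj A *m qadj Y *m N.
    by rewrite -[LHS]hNYA !qadjM hNN mulmxA.
  by rewrite -{1}YAY !mulmxA -{1}[Nh]mul1mx -NiN -(mulmxA Nhi) hN -!(mulmxA Nhi) e1 !mulmxA.
have eA : minor_mx G r *m G *m (Nhi *m qadj A) = qreal (dsum r G) *: (Nhi *m qadj A).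
  have := congr1 (fun X => X *m Ml) e.
  by rewrite KE -!scalemxAl -!mulmxA MMl !mulmx1.
rewrite -(mulmxA _ (qadj A)).
apply: (cramer_assemble AM NiN NY); by rewrite -GE.
Qed.

(** At rank [n] the recursion stops, since the matrix of order [n + 1] vanishes: [minor_mx G n *m G]
    is scalar, and the normal equation [qadj A *m M = G *m Y] is solved directly. *)
Lemma wmp_cramer_full m n (A : 'M[H]_(m, n)) (M Mh Ml : 'M[H]_m) (N : 'M[H]_n)
    (Y : 'M[H]_(n, m)) :
  trace_rank A n -> qhermitian Mh -> Ml *m Mh = 1%:M ->
  Mh *m Mh = M -> wmp M N A Y ->
  let G := qadj A *m M *m A in
  dsum n G != 0 /\ minor_mx G n *m qadj A *m M = qreal (dsum n G) *: Y.
Proof.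
move=> Ar hMh MlM hM [AYA _ hMAY _] G.
have GE : G = qadj (Mh *m A) *m (Mh *m A) by rewrite /G qadjM hMh -hM !mulmxA.
have Kr : trace_rank (Mh *m A) n.
  rewrite -[Mh *m A]mulmx1; exact: (trace_rank_mul MlM (mul1mx _)).
split; first by rewrite GE; have [] := trace_rank_gram Kr.
have hG : qhermitian G by rewrite GE; apply: gram_hermitian.
have hMM : qadj M = M by rewrite -hM qadjM hMh.
have AM : qadj A *m M = G *m Y.
  rewrite -{1}hMM -qadjM -{1}AYA !mulmxA qadjM hMAY.
  by rewrite !mulmxA.
rewrite -mulmxA AM mulmxA -mul_scalar_mx -(minor_mxS hG).
by rewrite (minor_mx_big _ (ltnSn n)) addr0.
Qed.

(** Adjunction exchanges the two sides and inverts the weights; the right factor of the solution is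
    thereby reduced to the left one. *)
Lemma wmp_adj m n (M Mi : 'M[H]_m) (N Ni : 'M[H]_n) (A : 'M[H]_(m, n)) Y :
  qhermitian M -> qhermitian N -> M *m Mi = 1%:M -> Mi *m M = 1%:M ->
  N *m Ni = 1%:M -> Ni *m N = 1%:M -> wmp M N A Y ->
  wmp Ni Mi (qadj A) (qadj Y).
Proof.
move=> hM hN MMi MiM NNi NiN [AYA YAY hMAY hNYA].
have hMi := qadj_inv hM MMi MiM; have hNi := qadj_inv hN NNi NiN.
split.
- by rewrite -!qadjM mulmxA AYA.
- by rewrite -!qadjM mulmxA YAY.
- rewrite /qhermitian !qadjM !qadjK hNi.
  have e : N *m Y *m A = qadj A *m qadj Y *m N.
    by rewrite -[LHS]hNYA !qadjM hN mulmxA.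
  rewrite -[LHS]mul1mx -NiN -!mulmxA (mulmxA Y) (mulmxA N) (mulmxA N) e.
  by rewrite -!mulmxA NNi mulmx1.
- rewrite /qhermitian !qadjM !qadjK hMi.
  have e : M *m A *m Y = qadj Y *m qadj A *m M.
    by rewrite -[LHS]hMAY !qadjM hM mulmxA.
  rewrite -[LHS]mul1mx -MiM -!mulmxA (mulmxA A) (mulmxA M) (mulmxA M) e.
  by rewrite -!mulmxA MMi mulmx1.
Qed.

(** Here [f] and [g] are the column and row numerators. Applying them in either order computes the
    same entry of [U Dt V], by associativity. *)
Lemma two_sided_formula n p (U : 'M[H]_n) (V : 'M[H]_p) (Dt X : 'M[H]_(n, p)) (d : R)
    (f : 'cV[H]_n -> 'I_n -> H) (g : 'rV[H]_p -> 'I_p -> H) :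
  (forall b i, f b i = (U *m b) i 0) -> (forall b j, g b j = (b *m V) 0 j) ->
  d != 0 -> U *m Dt *m V = qreal d *: X ->
  forall i j, X i j = f (\col_t g (row t Dt) j) i * qreal d^-1 /\
              X i j = g (\row_t f (col t Dt) i) j * qreal d^-1.
Proof.
move=> hf hg d0 e i j.
have -> : f (\col_t g (row t Dt) j) i = (U *m Dt *m V) i j.
  rewrite hf -mulmxA !mxE; apply: eq_bigr => t _; rewrite !mxE hg mxE.
  by congr (_ * _); apply: eq_bigr => s _; rewrite mxE.
have -> : g (\row_t f (col t Dt) i) j = (U *m Dt *m V) i j.
  rewrite hg !mxE; apply: eq_bigr => t _; rewrite !mxE hf mxE.
  by congr (_ * _); apply: eq_bigr => s _; rewrite mxE.
have -> : (U *m Dt *m V) i j * qreal d^-1 = X i j; last by [].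
by rewrite e mxE -qrealC mulrA -rmorphM mulVf // rmorph1 mul1r.
Qed.

End QuaternionMatrices.

(** * The four rank cases *)

Theorem theorem3p2 (R : rcfType) (m n p q : nat)
  (A : 'M[quat R]_(m, n)) (B : 'M[quat R]_(p, q)) (D : 'M[quat R]_(m, q))
  (M : 'M[quat R]_m) (N : 'M[quat R]_n) (P : 'M[quat R]_p) (Q : 'M[quat R]_q)
  (r1 r2 : nat)
  (Mh : 'M[quat R]_m) (Nh Nhi Ni : 'M[quat R]_n) (Ph : 'M[quat R]_p)
  (Qh Qhi Qi : 'M[quat R]_q)
  (YA : 'M[quat R]_(n, m)) (YB : 'M[quat R]_(q, p)) :
  (* ranks *)
  (0 < r1)%N -> qrank A r1 -> (0 < r2)%N -> qrank B r2 ->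
  (* weights: Hermitian positive definite *)
  qposdef M -> qposdef N -> qposdef P -> qposdef Q ->
  (* Mh = M^{1/2}, Nh = N^{1/2}, Ph = P^{1/2}, Qh = Q^{1/2} *)
  qposdef Mh -> Mh *m Mh = M ->
  qposdef Nh -> Nh *m Nh = N ->
  qposdef Ph -> Ph *m Ph = P ->
  qposdef Qh -> Qh *m Qh = Q ->
  (* Nhi = N^{-1/2}, Qhi = Q^{-1/2}, Ni = N^{-1}, Qi = Q^{-1} *)
  Nh *m Nhi = 1%:M -> Nhi *m Nh = 1%:M ->
  Qh *m Qhi = 1%:M -> Qhi *m Qh = 1%:M ->
  N *m Ni = 1%:M -> Ni *m N = 1%:M ->
  Q *m Qi = 1%:M -> Qi *m Q = 1%:M ->
  (* YA = A^dagger_{M,N}, YB = B^dagger_{P,Q} *)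
  wmp M N A YA -> wmp P Q B YB ->
  (* A^sharp A and B B^sharp are non-Hermitian *)
  ~ qhermitian (Ni *m qadj A *m M *m A) ->
  ~ qhermitian (B *m (Qi *m qadj B *m P)) ->
  let X := YA *m D *m YB in
  let At := Mh *m A *m Nhi in
  let Bt := Ph *m B *m Qhi in
  let AtA := qadj At *m At in
  let BBt := Bt *m qadj Bt in
  let AMA := qadj A *m M *m A in
  let BQB := B *m Qi *m qadj B in
  let DeltaA := dsum r1 AtA in
  let DeltaB := dsum r2 BBt in
  (* the building blocks of the formulas, for a given Dt in H^{n x p} *)
  let dB1 (Dt : 'M[quat R]_(n, p)) (j : 'I_p) : 'cV[quat R]_n :=
    \col_t \sum_(l < p) rdsum r2 BBt l (row t Dt) * Ph l j in
  let dA1 (Dt : 'M[quat R]_(n, p)) (i : 'I_n) : 'rV[quat R]_p :=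
    \row_f \sum_(k < n) Nhi i k * cdsum r1 AtA k (col f Dt) in
  let dB2 (Dt : 'M[quat R]_(n, p)) (j : 'I_p) : 'cV[quat R]_n :=
    \col_t rdet (rowrep BQB j (row t Dt)) j in
  let dA2 (Dt : 'M[quat R]_(n, p)) (i : 'I_n) : 'rV[quat R]_p :=
    \row_f cdet (colrep AMA i (col f Dt)) i in
  let numA1 (b : 'cV[quat R]_n) (i : 'I_n) := \sum_(k < n) Nhi i k * cdsum r1 AtA k b in
  let numB1 (b : 'rV[quat R]_p) (j : 'I_p) := \sum_(l < p) rdsum r2 BBt l b * Ph l j in
  let numA2 (b : 'cV[quat R]_n) (i : 'I_n) := cdet (colrep AMA i b) i in
  let numB2 (b : 'rV[quat R]_p) (j : 'I_p) := rdet (rowrep BQB j b) j in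
  (* (i) *)
  ((r1 < n)%N -> (r2 < p)%N ->
    let Dt := Nhi *m qadj A *m M *m D *m Qi *m qadj B *m Ph in
    forall (i : 'I_n) (j : 'I_p),
      X i j = numA1 (dB1 Dt j) i * qreal (DeltaA * DeltaB)^-1 /\
      X i j = numB1 (dA1 Dt i) j * qreal (DeltaA * DeltaB)^-1) /\
  (* (ii) *)
  (r1 = n -> r2 = p ->
    let Dt := qadj A *m M *m D *m Qi *m qadj B in
    forall (i : 'I_n) (j : 'I_p),
      X i j = numA2 (dB2 Dt j) i * qreal (hdet AMA * hdet BQB)^-1 /\
      X i j = numB2 (dA2 Dt i) j * qreal (hdet AMA * hdet BQB)^-1) /\
  (* (iii) *)
  (r1 = n -> (r2 < p)%N ->
    let Dt := qadj A *m M *m D *m Qi *m qadj B *m Ph in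
    forall (i : 'I_n) (j : 'I_p),
      X i j = numA2 (dB1 Dt j) i * qreal (hdet AMA * DeltaB)^-1 /\
      X i j = numB1 (dA2 Dt i) j * qreal (hdet AMA * DeltaB)^-1) /\
  (* (iv) *)
  ((r1 < n)%N -> r2 = p ->
    let Dt := Nhi *m qadj A *m M *m D *m Qi *m qadj B in
    forall (i : 'I_n) (j : 'I_p),
      X i j = numB2 (dA1 Dt i) j * qreal (DeltaA * hdet BQB)^-1 /\
      X i j = numA1 (dB2 Dt j) i * qreal (DeltaA * hdet BQB)^-1).
Proof.
move=> r1_gt0 rkA r2_gt0 rkB pM pN pP pQ pMh eM pNh eN pPh eP pQh eQ NNi NiN QQi QiQ
  NN NN' QQ QQ' wA wB _ _ X At Bt AtA BBt AMA BQB DeltaA DeltaB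
  dB1 dA1 dB2 dA2 numA1 numB1 numA2 numB2.
have [hM _] := pM; have [hP _] := pP; have [hQ _] := pQ.
have [hMh _] := pMh; have [hNh _] := pNh; have [hPh _] := pPh; have [hQh _] := pQh.
have [Ml MlM MMl] := posdef_inverse pMh.
have [Pi PiP PPi] := posdef_inverse pP.
have [Phi PhiP PPhi] := posdef_inverse pPh.
have hQi := qadj_inv hQ QQ QQ'; have hQhi := qadj_inv hQh QQi QiQ.
have hPhi := qadj_inv hPh PPhi PhiP.
(* The adjoint of [B] carries the weights [Qi] and [Pi], whose square roots are [Qhi] and [Phi]. *)
have eQi : Qhi *m Qhi = Qi.
  rewrite -[LHS]mul1mx -QQ' -eQ -!mulmxA (mulmxA Qh Qhi) QQi mul1mx QQi.
  by rewrite mulmx1.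
have ePi : Phi *m Phi = Pi.
  rewrite -[LHS]mul1mx -PiP -eP -!mulmxA (mulmxA Ph Phi) PPhi mul1mx PPhi.
  by rewrite mulmx1.
have trA : trace_rank A r1 := qrank_trace_rank rkA.
have trB : trace_rank (qadj B) r2 := trace_rank_adj (qrank_trace_rank rkB).
have wB' : wmp Qi Pi (qadj B) (qadj YB) := wmp_adj hP hQ PPi PiP QQ QQ' wB.
have hAtA : qhermitian AtA := gram_hermitian At.
have hBBt : qhermitian BBt by rewrite /BBt -{1}(qadjK Bt); apply: gram_hermitian.
have hAMA : qhermitian AMA by rewrite /qhermitian !qadjM qadjK hM mulmxA.
have hBQB : qhermitian BQB by rewrite /qhermitian !qadjM qadjK hQi mulmxA.
have hA1 b i : numA1 b i = (Nhi *m minor_mx AtA r1 *m b) i 0.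
  by rewrite -mulmxA mxE; apply: eq_bigr => k _; rewrite cdsumE.
have hA2 b i : numA2 b i = (minor_mx AMA n *m b) i 0 by apply: cdetE.
have hB1 b j : numB1 b j = (b *m (qadj (minor_mx BBt r2) *m Ph)) 0 j.
  by rewrite mulmxA [RHS]mxE; apply: eq_bigr => l _; rewrite rdsumE.
have hB2 b j : numB2 b j = (b *m qadj (minor_mx BQB p)) 0 j by apply: rdetE.
have [DA0 EA] := wmp_cramer trA hMh MlM MMl eM hNh eN NNi NiN wA.
rewrite -/At -/AtA -/DeltaA in DA0 EA.
(* The right factor: the left-hand formula for [qadj B] with inverted weights, followed by
   adjunction. *)
have [DB0 EB] : DeltaB != 0 /\
    Qi *m qadj B *m Ph *m (qadj (minor_mx BBt r2) *m Ph) = qreal DeltaB *: YB.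
  have := wmp_cramer trB hQhi QQi QiQ eQi hPhi ePi PhiP PPhi wB'.
  have -> : Qhi *m qadj B *m Ph = qadj Bt by rewrite !qadjM hQhi hPh mulmxA.
  rewrite /= qadjK -/BBt -/DeltaB => -[DB0 e]; split; first exact: DB0.
  have := congr1 (@qadj R _ _) e; rewrite qadjZ !qadjK => <-.
  by rewrite !qadjM ?qadjK hPh hQi !mulmxA.
have fullA : r1 = n -> hdet AMA != 0 /\
    minor_mx AMA n *m qadj A *m M = qreal (hdet AMA) *: YA.
  move=> r1n; rewrite r1n in trA; rewrite (hdetE hAMA).
  exact: (wmp_cramer_full trA hMh MlM eM wA).
have fullB : r2 = p -> hdet BQB != 0 /\
    Qi *m qadj B *m qadj (minor_mx BQB p) = qreal (hdet BQB) *: YB.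
  move=> r2p; rewrite r2p in trB; rewrite (hdetE hBQB).
  have := wmp_cramer_full trB hQhi QQi eQi wB'; cbv zeta.
  have -> : qadj (qadj B) *m Qi *m qadj B = BQB by rewrite qadjK.
  move=> [DB e]; split; first exact: DB.
  have := congr1 (@qadj R _ _) e; rewrite qadjZ !qadjK => <-.
  rewrite !qadjM ?qadjK hQi mulmxA; reflexivity.
(* Real scalars are central, so the two one-sided formulas multiply and their denominators
   combine. *)
have assemble a b (E : 'M[quat R]_(n, m)) (F : 'M[quat R]_(q, p)) :
    E = qreal a *: YA -> F = qreal b *: YB ->
    E *m D *m F = qreal (a * b) *: X.
  by move=> -> ->; rewrite mulmxZ -!scalemxAl scalerA -rmorphM mulrC.
split; [|split; [|split]].
- move=> _ _ Dt; apply: (two_sided_formula hA1 hB1); first by rewrite mulf_neq0.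
  by rewrite -(assemble _ _ _ _ EA EB) !mulmxA.
- move=> /fullA[DA EA'] /fullB[DB EB'] Dt.
  apply: (two_sided_formula hA2 hB2); first by rewrite mulf_neq0.
  by rewrite -(assemble _ _ _ _ EA' EB') !mulmxA.
- move=> /fullA[DA EA'] _ Dt.
  apply: (two_sided_formula hA2 hB1); first by rewrite mulf_neq0.
  by rewrite -(assemble _ _ _ _ EA' EB) !mulmxA.
(* In this case the row formula is stated first, so the two halves are exchanged. *)
- move=> _ /fullB[DB EB'] Dt i j.
  have [] := two_sided_formula hA1 hB2 (mulf_neq0 DA0 DB) _ i j (Dt := Dt) (X := X).
    by rewrite -(assemble _ _ _ _ EA EB') !mulmxA.
  by split.
Qed.
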